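(* Let $(K_f,A_g)$ be a Riemann–Roch pair on a lattice $\Lambda$ and let $d=\deg(g)$. Then there is a dualizing morphism, that is, an involution $(-)^\vee\colon K_f\to K_f$ with $[T^u]^\vee=[T^{-u}]$ for all $u\in\Lambda$. Furthermore, there is an element $\omega\in\mathbb{Q}K_f$, called the dualizing class, uniquely determined by the relation $$\chi_f(\xi)=(-1)^d\chi_f(\omega\cdot\xi^\vee)\qquad\text{for all }\xi\in\mathbb{Q}K_f .$$ If there exists a cotangent class, that is, an element $\Omega\in K_f$ with $\mathrm{td}=\mathrm{Td}(\Omega^\vee)$, then $\omega=\det(\Omega)$.
   Context: A lattice $\Lambda$ is a free abelian group of finite rank; $P(\Lambda)$ is the ring of polynomial functions $\Lambda\to\mathbb{Q}$ with rational coefficients. $\mathrm{Sh}(\Lambda)=\mathbb{Z}[\Lambda]$ is the group ring with basis $T^u$, acting on functions by $(T^uh)(x)=h(x+u)$. $\mathrm{Diff}(\Lambda)$ is the ring of differential operators with constant integer coefficients acting on $P(\Lambda)$; $\partial_u$ is the directional derivative along $u$. $\mathbb{Q}R=\mathbb{Q}\otimes_{\mathbb{Z}}R$. $K_f=\mathrm{Sh}(\Lambda)/\mathrm{Ann}(f)$, $A_g=\mathrm{Diff}(\Lambda)/\mathrm{Ann}(g)$ ($\mathrm{Ann}$: ideal of operators killing the polynomial); $[D]\cdot g:=D\cdot g$ for $[D]\in \mathbb{Q}A_g$. $(K_f,A_g)$ is a Riemann–Roch pair if $f,g\in P(\Lambda)$, $g$ is homogeneous and there is a unit $\mathrm{td}\in(\mathbb{Q}A_g)^\times$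 (the Todd class; it is unique) with $f=\mathrm{td}\cdot g$. $\chi_f\colon\mathbb{Q}K_f\to\mathbb{Q}$ is the linear map $\chi_f([E])=(E\cdot f)(0)$. An involution of a ring is a ring endomorphism whose square is the identity; $(-)^\vee$ is extended $\mathbb{Q}$-linearly to $\mathbb{Q}K_f$. For a Riemann–Roch pair there are unique homomorphisms from the additive group of $K_f$ to multiplicative groups as follows: the Todd operator $\mathrm{Td}\colon K_f\to(\mathbb{Q}A_g)^\times$ with $\mathrm{Td}([T^u])=\frac{[\partial_u]}{1-\exp(-[\partial_u])}$ (power series evaluated at the nilpotent element $[\partial_u]$), and the determinant $\det\colon K_f\to K_f^\times$ with $\det([T^u])=[T^u]$, for all $u\in\Lambda$. *)

(* Defs.v *)
From HB Require Import structures.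
From mathcomp Require Import all_boot all_order all_algebra.
From mathcomp Require Import boolp.
From mathcomp Require Import ssrcomplements mpoly freeg.
From mathcomp Require Import zify ring lra.

Set Implicit Arguments.
Unset Strict Implicit.
Unset Printing Implicit Defensive.

Import Order.TTheory GRing.Theory Num.Theory.

Local Open Scope ring_scope.
Local Open Scope quotient_scope.


(* Qtensor R is the tensor product of Q and R over Z, as the ring of fractions
   r / n with r : R and n > 0; the pair (r, n) stands for r / n.+1. *)
Section Rationalization.
Variable R : comPzRingType.

Definition qequiv (x y : R * nat) : bool :=
  `[< exists2 k, (0 < k)%N & x.1 *+ (y.2.+1 * k) = y.1 *+ (x.2.+1 * k) >].

Lemma qequiv_is_equiv : equiv_class_of qequiv.
Proof.
split=> [x|x y|y x z].
- by apply/asboolP; exists 1%N.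
- by apply/asboolP/asboolP => -[k k0 e]; exists k.
- move=> /asboolP[k k0 e1] /asboolP[l l0 e2]; apply/asboolP.
  exists (y.2.+1 * k * l)%N; first by rewrite !muln_gt0 k0 l0.
  transitivity (x.1 *+ (y.2.+1 * k) *+ (z.2.+1 * l)).
    by rewrite -mulrnA; congr (_ *+ _); lia.
  transitivity (y.1 *+ (z.2.+1 * l) *+ (x.2.+1 * k)).
    by rewrite e1 -!mulrnA; congr (_ *+ _); lia.
  by rewrite e2 -mulrnA; congr (_ *+ _); lia.
Qed.

Canonical qequiv_equiv := EquivRelPack qequiv_is_equiv.

Definition Qtensor : Type := {eq_quot qequiv}.
HB.instance Definition _ := EqQuotient.on Qtensor.
HB.instance Definition _ := Choice.on Qtensor.

Definition qfrac (r : R) (n : nat) : Qtensor := \pi_Qtensor (r, n.-1).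

Lemma qfracP (x : Qtensor) : exists r n, (0 < n)%N /\ x = qfrac r n.
Proof.
rewrite -[x]reprK; case: (repr x) => r n.
by exists r, n.+1.
Qed.

Lemma qfrac_eq r s n m : (0 < n)%N -> (0 < m)%N ->
  qfrac r n = qfrac s m <->
  exists2 k, (0 < k)%N & r *+ (m * k) = s *+ (n * k).
Proof.
move=> n0 m0; split=> [/eqmodP/asboolP|h]; last apply/eqmodP/asboolP.
  by rewrite /= !prednK.
by rewrite /= !prednK.
Qed.

Lemma qfrac_eq1 r s n m : (0 < n)%N -> (0 < m)%N ->
  r *+ m = s *+ n -> qfrac r n = qfrac s m.
Proof. by move=> n0 m0 e; apply/qfrac_eq => //; exists 1%N; rewrite ?muln1. Qed.

Definition qadd (x y : Qtensor) : Qtensor :=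
  let: (r, n) := repr x in let: (s, m) := repr y in
  qfrac (r *+ m.+1 + s *+ n.+1) (n.+1 * m.+1).
Definition qmul (x y : Qtensor) : Qtensor :=
  let: (r, n) := repr x in let: (s, m) := repr y in
  qfrac (r * s) (n.+1 * m.+1).
Definition qopp (x : Qtensor) : Qtensor :=
  let: (r, n) := repr x in qfrac (- r) n.+1.
Definition qscale (a : rat) (x : Qtensor) : Qtensor :=
  let: (r, n) := repr x in qfrac (r *~ numq a) (`|denq a| * n.+1).

Lemma repr_qfrac r n : (0 < n)%N ->
  exists2 k, (0 < k)%N &
   (repr (qfrac r n)).1 *+ (n * k) = r *+ ((repr (qfrac r n)).2.+1 * k).
Proof.
move=> n0; have : qfrac (repr (qfrac r n)).1 (repr (qfrac r n)).2.+1 = qfrac r n.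
  rewrite {1}/qfrac /= -surjective_pairing; exact: reprK.
by move/qfrac_eq; apply.
Qed.

Lemma qaddE r s n m : (0 < n)%N -> (0 < m)%N ->
  qadd (qfrac r n) (qfrac s m) = qfrac (r *+ m + s *+ n) (n * m).
Proof.
move=> n0 m0; rewrite /qadd.
have [k k0] := repr_qfrac r n0; have [l l0] := repr_qfrac s m0.
case: (repr _) => s' m'; case: (repr _) => r' n' /= e1 e2.
apply/qfrac_eq; rewrite ?muln_gt0 ?n0 //.
exists (k * l)%N; first by rewrite muln_gt0 k0.
rewrite !mulrnDl -!mulrnA; congr (_ + _).
  transitivity (r' *+ (n * k) *+ (m'.+1 * m * l)).
    by rewrite -mulrnA; congr (_ *+ _); lia.
  by rewrite e2 -mulrnA; congr (_ *+ _); lia.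
transitivity (s' *+ (m * l) *+ (n'.+1 * n * k)).
  by rewrite -mulrnA; congr (_ *+ _); lia.
by rewrite e1 -mulrnA; congr (_ *+ _); lia.
Qed.

Lemma mulrzn (x : R) (z : int) (k : nat) : x *+ k *~ z = x *~ z *+ k.
Proof. by rewrite !pmulrn -!mulrzA mulrC. Qed.

Lemma qmulE r s n m : (0 < n)%N -> (0 < m)%N ->
  qmul (qfrac r n) (qfrac s m) = qfrac (r * s) (n * m).
Proof.
move=> n0 m0; rewrite /qmul.
have [k k0] := repr_qfrac r n0; have [l l0] := repr_qfrac s m0.
case: (repr _) => s' m'; case: (repr _) => r' n' /= e1 e2.
apply/qfrac_eq; rewrite ?muln_gt0 ?n0 //.
exists (k * l)%N; first by rewrite muln_gt0 k0.
transitivity ((r' *+ (n * k)) * (s' *+ (m * l))).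
  by rewrite mulrnAl mulrnAr -mulrnA; congr (_ *+ _); lia.
by rewrite e1 e2 mulrnAl mulrnAr -mulrnA; congr (_ *+ _); lia.
Qed.

Lemma qoppE r n : (0 < n)%N -> qopp (qfrac r n) = qfrac (- r) n.
Proof.
move=> n0; rewrite /qopp; have [k k0] := repr_qfrac r n0.
case: (repr _) => r' n' /= e; apply/qfrac_eq => //.
by exists k; rewrite // !mulNrn e.
Qed.

Lemma qscaleE a r n : (0 < n)%N ->
  qscale a (qfrac r n) = qfrac (r *~ numq a) (`|denq a| * n).
Proof.
move=> n0; rewrite /qscale; have [k k0] := repr_qfrac r n0.
have d0 : (0 < `|denq a|)%N by rewrite absz_gt0 denq_neq0.
case: (repr _) => r' n' /= e; apply/qfrac_eq; rewrite ?muln_gt0 ?d0 //.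
exists k => //; rewrite -!mulnA.
transitivity (r' *+ (n * k) *~ numq a *+ `|denq a|%N).
  by rewrite mulrzn -mulrnA; congr (_ *+ _); lia.
by rewrite e mulrzn -mulrnA; congr (_ *+ _); lia.
Qed.

Lemma qaddA : associative qadd.
Proof.
move=> x y z; have [r [n [n0 ->]]] := qfracP x.
have [s [m [m0 ->]]] := qfracP y; have [t [p [p0 ->]]] := qfracP z.
rewrite !qaddE ?muln_gt0 ?n0 ?m0 //; congr qfrac; last by rewrite mulnA.
by rewrite !mulrnDl -!mulrnA addrA; congr (_ *+ _ + _ *+ _ + _ *+ _); lia.
Qed.

Lemma qaddC : commutative qadd.
Proof.
move=> x y; have [r [n [n0 ->]]] := qfracP x.
have [s [m [m0 ->]]] := qfracP y.
by rewrite !qaddE // addrC mulnC.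
Qed.

Lemma qadd0 : left_id (qfrac 0 1) qadd.
Proof.
move=> x; have [r [n [n0 ->]]] := qfracP x.
by rewrite qaddE // mul0rn add0r mul1n.
Qed.

Lemma qaddN : left_inverse (qfrac 0 1) qopp qadd.
Proof.
move=> x; have [r [n [n0 ->]]] := qfracP x.
rewrite qoppE // qaddE // mulNrn addNr.
by apply: qfrac_eq1; rewrite ?muln_gt0 ?n0 // !mul0rn.
Qed.

HB.instance Definition _ := GRing.isZmodule.Build Qtensor qaddA qaddC qadd0 qaddN.

Lemma qmulA : associative qmul.
Proof.
move=> x y z; have [r [n [n0 ->]]] := qfracP x.
have [s [m [m0 ->]]] := qfracP y; have [t [p [p0 ->]]] := qfracP z.
by rewrite !qmulE ?muln_gt0 ?n0 ?m0 // mulrA mulnA.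
Qed.

Lemma qmulC : commutative qmul.
Proof.
move=> x y; have [r [n [n0 ->]]] := qfracP x.
have [s [m [m0 ->]]] := qfracP y.
by rewrite !qmulE // mulrC mulnC.
Qed.

Lemma qmul1 : left_id (qfrac 1 1) qmul.
Proof.
move=> x; have [r [n [n0 ->]]] := qfracP x.
by rewrite qmulE // mul1r mul1n.
Qed.

Lemma qmulDl : left_distributive qmul qadd.
Proof.
move=> x y z; have [r [n [n0 ->]]] := qfracP x.
have [s [m [m0 ->]]] := qfracP y; have [t [p [p0 ->]]] := qfracP z.
rewrite !(qaddE, qmulE) ?muln_gt0 ?n0 ?m0 //.
apply: qfrac_eq1; rewrite ?muln_gt0 ?n0 ?m0 ?p0 //.
rewrite !(mulrDl, mulrnDl, mulrnAl) -!mulrnA.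
by congr (_ *+ _ + _ *+ _); lia.
Qed.

HB.instance Definition _ :=
  GRing.Zmodule_isComPzRing.Build Qtensor qmulA qmulC qmul1 qmulDl.

Lemma ratE (a : rat) : exists (p : int) (q : nat),
  (0 < q)%N /\ a = p%:~R / q%:R.
Proof.
exists (numq a), `|denq a|%N; split; first by rewrite absz_gt0 denq_neq0.
by rewrite -[LHS]divq_num_den; congr (_ / _); rewrite -absz_denq.
Qed.

Lemma qscaleF (p : int) (q : nat) r n : (0 < q)%N -> (0 < n)%N ->
  qscale (p%:~R / q%:R) (qfrac r n) = qfrac (r *~ p) (q * n).
Proof.
move=> q0 n0; rewrite qscaleE //.
set a := (_ / _).
have d0 : (0 < `|denq a|)%N by rewrite absz_gt0 denq_neq0.
have e : numq a * q%:Z = p * `|denq a|%N.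
  apply: (@intr_inj rat); rewrite !rmorphM /= absz_denq.
  rewrite numqE /a mulrAC divfK // pnatr_eq0; lia.
apply: qfrac_eq1; rewrite ?muln_gt0 ?q0 ?d0 //.
by rewrite !mulrnA [r *~ _ *+ q]pmulrn -mulrzA e mulrzA -pmulrn.
Qed.

Lemma qscaleA a b x : qscale a (qscale b x) = qscale (a * b) x.
Proof.
have [r [n [n0 ->]]] := qfracP x.
have [p [q [q0 ->]]] := ratE a; have [s [t [t0 ->]]] := ratE b.
have -> : p%:~R / q%:R * (s%:~R / t%:R) = (p * s)%:~R / (q * t)%:R :> rat.
  by rewrite mulrACA -invfM intrM natrM.
rewrite !qscaleF ?muln_gt0 ?q0 ?t0 //.
by rewrite -mulrzA (mulrC s) mulnA.
Qed.

Lemma qscale1 : left_id 1 qscale.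
Proof.
move=> x; have [r [n [n0 ->]]] := qfracP x.
by rewrite qscaleE // (numq_int 1) (denq_int 1) mulr1z mul1n.
Qed.

Lemma qscaleDr : right_distributive qscale +%R.
Proof.
move=> a x y; have [r [n [n0 ->]]] := qfracP x.
have [s [m [m0 ->]]] := qfracP y; have [p [q [q0 ->]]] := ratE a.
rewrite [_ + _]qaddE // !qscaleF ?muln_gt0 ?n0 // [RHS]qaddE ?muln_gt0 ?q0 //.
apply: qfrac_eq1; rewrite ?muln_gt0 ?q0 ?n0 //.
rewrite mulrzDl !mulrzn !mulrnDl -!mulrnA.
by congr (_ *+ _ + _ *+ _); lia.
Qed.

Lemma qscaleDl x : {morph qscale^~ x : a b / a + b}.
Proof.
move=> a b; have [r [n [n0 ->]]] := qfracP x.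
have [p [q [q0 ->]]] := ratE a; have [s [t [t0 ->]]] := ratE b.
have -> : p%:~R / q%:R + s%:~R / t%:R = (p * t + s * q)%:~R / (q * t)%:R :> rat.
  by rewrite addf_div ?pnatr_eq0 -?lt0n // intrD !intrM natrM.
rewrite !qscaleF ?muln_gt0 ?q0 ?t0 // [RHS]qaddE ?muln_gt0 ?q0 ?t0 //.
apply: qfrac_eq1; rewrite ?muln_gt0 ?q0 ?t0 ?n0 //.
rewrite mulrzDr !mulrzA !mulrnDl -!pmulrn -!mulrnA.
by congr (_ *+ _ + _ *+ _); lia.
Qed.

HB.instance Definition _ := GRing.Zmodule_isLmodule.Build rat Qtensor
  qscaleA qscale1 qscaleDr qscaleDl.

Lemma qscaleAl (a : rat) (x y : Qtensor) : a *: (x * y) = a *: x * y.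
Proof.
have [r [n [n0 ->]]] := qfracP x; have [s [m [m0 ->]]] := qfracP y.
have [p [q [q0 ->]]] := ratE a.
rewrite [qfrac r n * qfrac s m]qmulE // [LHS]qscaleF ?muln_gt0 ?n0 //.
rewrite [_ *: qfrac r n]qscaleF // [RHS]qmulE ?muln_gt0 ?q0 //.
by rewrite mulrzAl mulnA.
Qed.

Definition inQ (r : R) : Qtensor := qfrac r 1.

Lemma inQ_is_zmod_morphism : zmod_morphism inQ.
Proof.
move=> r s; by rewrite /inQ [- qfrac s 1]qoppE // [RHS]qaddE.
Qed.

Lemma inQ_is_monoid_morphism : monoid_morphism inQ.
Proof. by split=> // r s; rewrite [RHS]qmulE. Qed.

HB.instance Definition _ :=
  GRing.isZmodMorphism.Build R Qtensor inQ inQ_is_zmod_morphism.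
HB.instance Definition _ :=
  GRing.isMonoidMorphism.Build R Qtensor inQ inQ_is_monoid_morphism.

Lemma qfracE r n : (0 < n)%N -> qfrac r n = n%:R^-1 *: inQ r.
Proof.
move=> n0; rewrite -[_^-1]mul1r -[1]/(1%:~R) [RHS]qscaleF //.
by rewrite muln1.
Qed.

Section Extension.
Variables (V : lmodType rat) (phi : R -> V).

(* The Q-linear extension of phi when phi is additive: Qext_is_linear, Qext_inQ *)
Definition Qext (x : Qtensor) : V :=
  let: (r, n) := repr x in n.+1%:R^-1 *: phi r.
End Extension.

Lemma Qext_frac (V : lmodType rat) (phi : {additive R -> V}) r n :
  (0 < n)%N -> Qext phi (qfrac r n) = n%:R^-1 *: phi r.
Proof.
move=> n0; rewrite /Qext; have [k k0] := repr_qfrac r n0.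
case: (repr _) => r' n' /= /(congr1 phi); rewrite !raddfMn /= => e.
have u l : (0 < l)%N -> (l%:R : rat) != 0 by rewrite pnatr_eq0; lia.
apply: (@scalerI _ _ ((n'.+1 * n * k)%:R : rat)).
  by rewrite u ?muln_gt0 ?n0.
rewrite !scalerA.
have -> : (n'.+1 * n * k)%:R / n'.+1%:R = (n * k)%:R :> rat.
  by rewrite -mulnA natrM mulrAC mulfV ?mul1r ?u.
have -> : (n'.+1 * n * k)%:R / n%:R = (n'.+1 * k)%:R :> rat.
  by rewrite mulnAC natrM mulfK ?u.
by rewrite !scaler_nat.
Qed.

Lemma Qext_is_linear (V : lmodType rat) (phi : {additive R -> V}) :
  linear (Qext phi).
Proof.
move=> a x y; have [r [n [n0 ->]]] := qfracP x.
have [s [m [m0 ->]]] := qfracP y; have [p [q [q0 ->]]] := ratE a.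
have u l : (0 < l)%N -> (l%:R : rat) != 0 by rewrite pnatr_eq0; lia.
rewrite [_ *: qfrac r n]qscaleF // [_ + qfrac s m]qaddE ?muln_gt0 ?q0 //.
rewrite !Qext_frac ?muln_gt0 ?q0 ?n0 // raddfD !raddfMn raddfMz /=.
rewrite -!scaler_nat -scaler_int !(scalerDr, scalerA).
congr (_ *: _ + _ *: _); rewrite !natrM; field; rewrite !u //.
Qed.

Lemma Qext_inQ (V : lmodType rat) (phi : {additive R -> V}) r :
  Qext phi (inQ r) = phi r.
Proof. by rewrite Qext_frac // invr1 scale1r. Qed.

End Rationalization.


(* The quotient S / Ann(m) for m in an S-module. The quotient rings of
   ring_quotient do not apply, as Ann(m) = S is allowed (m = 0). *)
Section AnnihilatorQuotient.
Variables (S : comPzRingType) (M : lmodType S) (m : M).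

Definition ann : {pred S} := [pred a : S | a *: m == 0].

Definition ann_equiv (a b : S) : bool := a - b \in ann.

Lemma ann_equivE a b : ann_equiv a b = (a *: m == b *: m).
Proof. by rewrite /ann_equiv inE /= scalerBl subr_eq0. Qed.

Lemma ann_equiv_is_equiv : equiv_class_of ann_equiv.
Proof.
split=> [a|a b|b a c]; rewrite !ann_equivE //.
by move=> /eqP-> /eqP->.
Qed.

Canonical ann_equiv_equiv := EquivRelPack ann_equiv_is_equiv.

Definition annquot : Type := {eq_quot ann_equiv}.
HB.instance Definition _ := EqQuotient.on annquot.
HB.instance Definition _ := Choice.on annquot.

Definition acls (a : S) : annquot := \pi_annquot a.
Definition aact (x : annquot) : M := repr x *: m.

Lemma acls_eq a b : acls a = acls b <-> a *: m = b *: m.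
Proof.
split=> [/eqmodP|h]; last apply/eqmodP.
  by rewrite /= ann_equivE => /eqP.
by rewrite /= ann_equivE; apply/eqP.
Qed.

Lemma aclsP x : exists a, x = acls a.
Proof. by exists (repr x); rewrite /acls reprK. Qed.

Lemma aact_cls a : aact (acls a) = a *: m.
Proof. by apply/acls_eq; rewrite /acls reprK. Qed.

Definition azero : annquot := acls 0.
Definition aone : annquot := acls 1.
Definition aopp (x : annquot) : annquot := acls (- repr x).
Definition aadd (x y : annquot) : annquot := acls (repr x + repr y).
Definition amul (x y : annquot) : annquot := acls (repr x * repr y).

Lemma repr_acls a : repr (acls a) *: m = a *: m.
Proof. exact: aact_cls. Qed.

Lemma aoppE a : aopp (acls a) = acls (- a).
Proof. by apply/acls_eq; rewrite !scaleNr repr_acls. Qed.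

Lemma aaddE a b : aadd (acls a) (acls b) = acls (a + b).
Proof. by apply/acls_eq; rewrite !scalerDl !repr_acls. Qed.

Lemma amulE a b : amul (acls a) (acls b) = acls (a * b).
Proof.
apply/acls_eq; rewrite -[LHS]scalerA repr_acls.
by rewrite scalerA mulrC -[LHS]scalerA repr_acls scalerA mulrC.
Qed.

Lemma aaddA : associative aadd.
Proof.
move=> x y z; have [a ->] := aclsP x; have [b ->] := aclsP y.
by have [c ->] := aclsP z; rewrite !aaddE addrA.
Qed.

Lemma aaddC : commutative aadd.
Proof. by move=> x y; rewrite /aadd addrC. Qed.

Lemma aadd0 : left_id azero aadd.
Proof. by move=> x; have [a ->] := aclsP x; rewrite aaddE add0r. Qed.

Lemma aaddN : left_inverse azero aopp aadd.
Proof. by move=> x; have [a ->] := aclsP x; rewrite aoppE aaddE addNr. Qed.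

HB.instance Definition _ :=
  GRing.isZmodule.Build annquot aaddA aaddC aadd0 aaddN.

Lemma amulA : associative amul.
Proof.
move=> x y z; have [a ->] := aclsP x; have [b ->] := aclsP y.
by have [c ->] := aclsP z; rewrite !amulE mulrA.
Qed.

Lemma amulC : commutative amul.
Proof. by move=> x y; rewrite /amul mulrC. Qed.

Lemma amul1 : left_id aone amul.
Proof. by move=> x; have [a ->] := aclsP x; rewrite amulE mul1r. Qed.

Lemma amulDl : left_distributive amul aadd.
Proof.
move=> x y z; have [a ->] := aclsP x; have [b ->] := aclsP y.
by have [c ->] := aclsP z; rewrite !(amulE, aaddE) mulrDl.
Qed.

HB.instance Definition _ :=
  GRing.Zmodule_isComPzRing.Build annquot amulA amulC amul1 amulDl.

Lemma acls_is_zmod_morphism : zmod_morphism acls.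
Proof. by move=> a b; rewrite [- acls b]aoppE [RHS]aaddE. Qed.

Lemma acls_is_monoid_morphism : monoid_morphism acls.
Proof. by split=> // a b; rewrite [RHS]amulE. Qed.

HB.instance Definition _ :=
  GRing.isZmodMorphism.Build S annquot acls acls_is_zmod_morphism.
HB.instance Definition _ :=
  GRing.isMonoidMorphism.Build S annquot acls acls_is_monoid_morphism.

Lemma aact_is_zmod_morphism : zmod_morphism aact.
Proof.
move=> x y; have [a ->] := aclsP x; have [b ->] := aclsP y.
by rewrite -raddfB !aact_cls scalerBl.
Qed.

HB.instance Definition _ :=
  GRing.isZmodMorphism.Build annquot M aact aact_is_zmod_morphism.

End AnnihilatorQuotient.


(* The group ring Z[V], with basis gU u = T^u *)
Section GroupRing.
Variable V : zmodType.

Definition groupring : Type := {freeg V / int}.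
HB.instance Definition _ := GRing.Zmodule.on groupring.

Implicit Types E F G : groupring.

Definition gU (u : V) : groupring := << u >>.

(* The additive extension of w to Z[V] *)
Definition glift (W : zmodType) (w : V -> W) (E : groupring) : W :=
  \sum_(u <- dom E) w u *~ coeff u E.

Section Glift.
Variables (W : zmodType) (w : V -> W).

Lemma gliftE s E : uniq s -> {subset dom E <= s} ->
  glift w E = \sum_(u <- s) w u *~ coeff u E.
Proof.
move=> us sub; rewrite [RHS](bigID (mem (dom E))) /= [X in _ + X]big1; last first.
  by move=> u /coeff_outdom->; rewrite mulr0z.
rewrite addr0 -big_filter; apply: perm_big; apply: uniq_perm.
- exact: uniq_dom.
- exact: filter_uniq.
by move=> u; rewrite mem_filter; case: (boolP (u \in dom E)) => //= /sub ->.
Qed.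

Lemma glift_is_zmod_morphism : zmod_morphism (glift w).
Proof.
move=> E F; pose s := undup (dom E ++ dom F).
have us : uniq s by exact: undup_uniq.
rewrite (@gliftE s) //; last by move=> u /domB; rewrite mem_undup.
rewrite (@gliftE s E) //; last by move=> u uE; rewrite mem_undup mem_cat uE.
rewrite (@gliftE s F) //; last by move=> u uF; rewrite mem_undup mem_cat uF orbT.
by rewrite -sumrB; apply: eq_bigr => u _; rewrite coeffB mulrzBr.
Qed.

HB.instance Definition _ :=
  GRing.isZmodMorphism.Build groupring W (glift w) glift_is_zmod_morphism.

Lemma gliftU u : glift w (gU u) = w u.
Proof. by rewrite /glift domU1 big_seq1 coeffU eqxx. Qed.

End Glift.

Lemma gr_ind (P : groupring -> Prop) : P 0 -> (forall u, P (gU u)) ->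
  (forall E, P E -> P (- E)) -> (forall E F, P E -> P F -> P (E + F)) ->
  forall E, P E.
Proof.
move=> P0 PU PN PD E; rewrite -[E]freeg_sumE.
apply: (big_ind P) => // i _; rewrite -[coeff i E]intz -freegU_mulz.
have Pn n : P (gU i *+ n).
  by elim: n => [|n IH]; rewrite ?mulr0n // mulrS; apply: PD.
case: (coeff i E) => n; first exact: Pn.
by rewrite NegzE mulrNz; apply/PN/Pn.
Qed.

Definition gr_mul E F : groupring :=
  glift (fun u => glift (fun v => gU (u + v)) F) E.

Lemma glift_eq (W : zmodType) (w w' : V -> W) : w =1 w' -> glift w =1 glift w'.
Proof. by move=> e E; apply: eq_bigr => u _; rewrite e. Qed.

Lemma gliftD (W : zmodType) (w w' : V -> W) E :
  glift (fun u => w u + w' u) E = glift w E + glift w' E.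
Proof. by rewrite -big_split; apply: eq_bigr => u _; rewrite mulrzDl. Qed.

Lemma gliftN (W : zmodType) (w : V -> W) E :
  glift (fun u => - w u) E = - glift w E.
Proof. by rewrite -sumrN; apply: eq_bigr => u _; rewrite mulNrz. Qed.

Lemma glift0 (W : zmodType) E : glift (fun=> 0 : W) E = 0.
Proof. by apply: big1 => u _; rewrite mul0rz. Qed.

Lemma gr_mulDl : left_distributive gr_mul +%R.
Proof. by move=> E F G; rewrite /gr_mul raddfD. Qed.

Lemma gr_mulDr : right_distributive gr_mul +%R.
Proof.
move=> E F G; rewrite /gr_mul -gliftD.
by apply: glift_eq => u; rewrite raddfD.
Qed.

Lemma gr_mul0 E : gr_mul 0 E = 0. Proof. exact: raddf0. Qed.

Lemma gr_mulr0 E : gr_mul E 0 = 0.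
Proof. by rewrite -[RHS](glift0 _ E); apply: glift_eq => u; rewrite raddf0. Qed.

Lemma gr_mulNl E F : gr_mul (- E) F = - gr_mul E F. Proof. exact: raddfN. Qed.

Lemma gr_mulNr E F : gr_mul E (- F) = - gr_mul E F.
Proof. by rewrite -gliftN; apply: glift_eq => u; rewrite raddfN. Qed.

Lemma gr_mulUU u v : gr_mul (gU u) (gU v) = gU (u + v).
Proof. by rewrite /gr_mul !gliftU. Qed.

Lemma gr_mulC : commutative gr_mul.
Proof.
move=> E F; elim/gr_ind: E => [|u|E IH|E1 E2 IH1 IH2].
- by rewrite gr_mul0 gr_mulr0.
- elim/gr_ind: F => [|v|F IH|F1 F2 IH1 IH2].
  + by rewrite gr_mul0 gr_mulr0.
  + by rewrite !gr_mulUU addrC.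
  + by rewrite gr_mulNl gr_mulNr IH.
  + by rewrite gr_mulDl gr_mulDr IH1 IH2.
- by rewrite gr_mulNl gr_mulNr IH.
- by rewrite gr_mulDl gr_mulDr IH1 IH2.
Qed.

Lemma gr_mulA : associative gr_mul.
Proof.
move=> E F G; elim/gr_ind: E => [|u|E IH|E1 E2 IH1 IH2].
- by rewrite !gr_mul0.
- elim/gr_ind: F => [|v|F IH|F1 F2 IH1 IH2].
  + by rewrite !(gr_mul0, gr_mulr0).
  + elim/gr_ind: G => [|w|G IH|G1 G2 IH1 IH2].
    * by rewrite !gr_mulr0.
    * by rewrite !gr_mulUU addrA.
    * by rewrite !gr_mulNr IH.
    * by rewrite !gr_mulDr IH1 IH2.
  + by rewrite !(gr_mulNl, gr_mulNr) IH.
  + by rewrite !(gr_mulDl, gr_mulDr) IH1 IH2.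
- by rewrite !gr_mulNl IH.
- by rewrite !gr_mulDl IH1 IH2.
Qed.

Lemma gr_mul1 : left_id (gU 0) gr_mul.
Proof.
elim/gr_ind => [|u|E IH|E1 E2 IH1 IH2]; rewrite ?gr_mulr0 //.
- by rewrite gr_mulUU add0r.
- by rewrite gr_mulNr IH.
- by rewrite gr_mulDr IH1 IH2.
Qed.

HB.instance Definition _ :=
  GRing.Zmodule_isComPzRing.Build groupring gr_mulA gr_mulC gr_mul1 gr_mulDl.

Lemma gU0 : gU 0 = 1. Proof. by []. Qed.

Lemma gUD u v : gU (u + v) = gU u * gU v.
Proof. by rewrite [RHS]gr_mulUU. Qed.
End GroupRing.


(* The coordinates only serve to write polynomials down. *)
Record lattice := Lattice {
  lat_group :> zmodType;
  rank : nat;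
  coord : {additive lat_group -> 'rV[int]_rank};
  coord_bij : bijective coord }.

(* A polynomial function is given by its polynomial in the coordinates, which
   it determines: pval_inj. *)
Notation polyfun L := {mpoly rat[rank L]}.
Notation Sh L := (groupring (lat_group L)).
(* 'X_i stands for the partial derivative in the i-th coordinate. *)
Notation Diff L := {mpoly int[rank L]}.

Section Operators.
Variable L : lattice.
Implicit Types (p q : polyfun L) (u v x : L) (D : Diff L) (E : Sh L).

Definition ratcoord u (i : 'I_(rank L)) : rat := (coord L u 0 i)%:~R.

Lemma ratcoordD u v i : ratcoord (u + v) i = ratcoord u i + ratcoord v i.
Proof. by rewrite /ratcoord raddfD mxE intrD. Qed.

Lemma ratcoord0 i : ratcoord 0 i = 0.
Proof. by rewrite /ratcoord raddf0 mxE. Qed.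

Definition pval p x : rat := p.@[ratcoord x].

Definition shift u p : polyfun L :=
  p \mPo [tuple 'X_i + (ratcoord u i)%:MP | i < rank L].

Lemma pval_shift u p x : pval (shift u p) x = pval p (x + u).
Proof.
rewrite /pval /shift comp_mpoly_meval; apply: meval_eq => i.
by rewrite tnth_mktuple mevalD mevalXU mevalC ratcoordD.
Qed.

Lemma shift_is_zmod_morphism u : zmod_morphism (shift u).
Proof. by move=> p q; rewrite /shift raddfB. Qed.

HB.instance Definition _ u :=
  GRing.isZmodMorphism.Build (polyfun L) (polyfun L) (shift u) (shift_is_zmod_morphism u).

Lemma shift0 p : shift 0 p = p.
Proof.
rewrite -[RHS]comp_mpoly_id /shift; congr (_ \mPo _).
by apply: eq_mktuple => i; rewrite ratcoord0 mpolyC0 addr0.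
Qed.

Lemma shiftD u v p : shift (u + v) p = shift u (shift v p).
Proof.
rewrite /shift; elim/mpolyind: p => [|c m p _ _ IH]; first by rewrite !raddf0.
rewrite !raddfD /= IH !comp_mpolyZ; congr (_ *: _ + _).
rewrite !comp_mpolyX rmorph_prod /=; apply: eq_bigr => i _.
rewrite rmorphXn /=; congr (_ ^+ _).
rewrite !tnth_mktuple raddfD /= comp_mpolyXU comp_mpolyC -tnth_nth tnth_mktuple.
by rewrite ratcoordD mpolyCD addrA.
Qed.

Definition shact E p : polyfun L := glift (fun u => shift u p) E.

Definition diffact D p : polyfun L := \sum_(m <- msupp D) p^`M[m] *~ D@_m.

Lemma diffactwE k D p : (msize D <= k)%N ->
  diffact D p = \sum_(m : 'X_{1..(rank L) < k}) p^`M[m] *~ D@_m.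
Proof.
move=> le; rewrite /diffact (big_mksub 'X_{1..(rank L) < k}) /=.
- rewrite big_rmcond //= => i; move/memN_msupp_eq0 => ->.
  by rewrite mulr0z.
- exact: msupp_uniq.
by move=> i /msize_mdeg_lt /leq_trans; apply.
Qed.

Definition diffact_to p D : polyfun L := diffact D p.

Lemma diffact_is_zmod_morphism p : zmod_morphism (diffact_to p).
Proof.
move=> D D'; rewrite /diffact_to; pose k := maxn (msize (D - D')) (maxn (msize D) (msize D')).
rewrite !(@diffactwE k) ?leq_max ?leqnn ?orbT // -sumrB.
by apply: eq_bigr => m _; rewrite mcoeffB mulrzBr.
Qed.

HB.instance Definition _ p :=
  GRing.isZmodMorphism.Build (Diff L) (polyfun L) (diffact_to p)
    (diffact_is_zmod_morphism p).

Lemma diffactX m p : diffact 'X_[m] p = p^`M[m].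
Proof. by rewrite /diffact msuppX big_seq1 mcoeffX eqxx. Qed.

Definition dirder u : Diff L := \sum_i 'X_i *~ coord L u 0 i.

Lemma diffact_dirder u p :
  diffact (dirder u) p = \sum_i ratcoord u i *: p^`M(i).
Proof.
rewrite [LHS](raddf_sum (diffact_to p)); apply: eq_bigr => i _ /=.
by rewrite [LHS](raddfMz (diffact_to p)) /= /diffact_to diffactX mderivmU1m scaler_int.
Qed.

End Operators.

(* polyfun L as a module over Sh L, resp. Diff L *)
Definition shmod (L : lattice) : Type := polyfun L.
HB.instance Definition _ L := GRing.Zmodule.on (shmod L).

Definition diffmod (L : lattice) : Type := polyfun L.
HB.instance Definition _ L := GRing.Zmodule.on (diffmod L).

Section Modules.
Variable L : lattice.

Lemma shactDr (E : Sh L) : {morph shact E : p q / p + q}.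
Proof.
by move=> p q; rewrite /shact -gliftD; apply: glift_eq => u; rewrite raddfD.
Qed.

Lemma shactN (E : Sh L) p : shact (- E) p = - shact E p.
Proof. exact: raddfN. Qed.

Lemma shactDl p : {morph (fun E : Sh L => shact E p) : E F / E + F}.
Proof. by move=> E F; exact: raddfD. Qed.

Lemma shactU u (p : polyfun L) : shact (gU u) p = shift u p.
Proof. by rewrite /shact gliftU. Qed.

Lemma shact1 : left_id 1 (@shact L).
Proof. by move=> p; rewrite -gU0 shactU shift0. Qed.

Lemma shactA (E F : Sh L) p : shact E (shact F p) = shact (E * F) p.
Proof.
have r0 G : shact G 0 = 0 :> polyfun L.
  by apply: (addrI (shact G 0)); rewrite -shactDr !addr0.
have rN G q : shact G (- q) = - shact G q :> polyfun L.
  by apply: (addrI (shact G q)); rewrite -shactDr !subrr r0.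
elim/gr_ind: E => [|u|E IH|E1 E2 IH1 IH2].
- by rewrite mul0r; rewrite /shact !raddf0.
- rewrite shactU; elim/gr_ind: F => [|v|F IH|F1 F2 IH1 IH2].
  + by rewrite mulr0 /shact !raddf0.
  + by rewrite -gUD !shactU shiftD.
  + by rewrite mulrN !shactN raddfN /= IH.
  + by rewrite mulrDr !shactDl raddfD /= IH1 IH2.
- by rewrite mulNr !shactN IH.
- by rewrite mulrDl !shactDl IH1 IH2.
Qed.

HB.instance Definition _ := GRing.Zmodule_isLmodule.Build (Sh L) (shmod L)
  shactA shact1 shactDr shactDl.

Lemma diffactDr (D : Diff L) : {morph diffact D : p q / p + q}.
Proof.
move=> p q; rewrite /diffact -big_split; apply: eq_bigr => m _ /=.
by rewrite mderivmD mulrzDl.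
Qed.

Lemma diffactDl (p : polyfun L) : {morph (fun D : Diff L => diffact D p) : D D' / D + D'}.
Proof. by move=> D D'; exact: (raddfD (diffact_to p)). Qed.

Lemma diffact1 : left_id 1 (@diffact L).
Proof. by move=> p; rewrite -mpolyX0 diffactX mderivm0m. Qed.

Lemma diffactA (D D' : Diff L) p : diffact D (diffact D' p) = diffact (D * D') p.
Proof.
have l0 q : diffact 0 q = 0 :> polyfun L by exact: (raddf0 (diffact_to q)).
have lZ c G q : diffact (c *: G) q = diffact G q *~ c :> polyfun L.
  by rewrite -[c in LHS]intz scaler_int; exact: (raddfMz (diffact_to q)).
have r0 G : diffact G 0 = 0 :> polyfun L.
  by apply: (addrI (diffact G 0)); rewrite -diffactDr !addr0.
have rN G q : diffact G (- q) = - diffact G q :> polyfun L.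
  by apply: (addrI (diffact G q)); rewrite -diffactDr !subrr r0.
have rM c G q : diffact G (q *~ c) = diffact G q *~ c :> polyfun L.
  have rMn n : diffact G (q *+ n) = diffact G q *+ n.
    by elim: n => [|n IH]; rewrite ?mulr0n ?r0 // !mulrS diffactDr IH.
  by case: c => n; rewrite ?NegzE ?mulrNz ?rN; [exact: rMn|congr (- _); exact: rMn].
elim/mpolyind: D => [|c m D _ _ IH]; first by rewrite mul0r !l0.
rewrite mulrDl !diffactDl IH -scalerAl !lZ; congr (_ *~ _ + _).
rewrite diffactX; elim/mpolyind: D' {IH} => [|d m' D' _ _ IH].
  by rewrite mulr0 !l0 raddf0.
rewrite mulrDr !diffactDl raddfD /= IH -scalerAr !lZ; congr (_ + _).
by rewrite raddfMz /= -mpolyXD !diffactX addmC mderivmDm.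
Qed.

HB.instance Definition _ := GRing.Zmodule_isLmodule.Build (Diff L) (diffmod L)
  diffactA diffact1 diffactDr diffactDl.

End Modules.


Section PolynomialFunctions.
Variable L : lattice.

Lemma mpoly_int_eq0 n (p : {mpoly rat[n]}) :
  (forall c : 'rV[int]_n, p.@[fun i => (c 0 i)%:~R] = 0) -> p = 0.
Proof.
move=> p0; pose R := {mpoly rat[n]}.
pose ev (v : 'I_n -> R) : R := mmap (@mpolyC n rat) v p.
suff H k : (k <= n)%N -> forall (c : 'rV[int]_n) (v : 'I_n -> R),
    (forall i : 'I_n, (k <= i)%N -> v i = (c 0 i)%:~R) -> ev v = 0.
  have := H n (leqnn n) 0 (fun i => 'X_i).
  rewrite /ev => <-.
    rewrite [LHS]mpolyE /mmap; apply: eq_bigr => m _.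
    by rewrite mmap1_id mul_mpolyC.
  by move=> i; rewrite leqNgt ltn_ord.
elim: k => [|k IH] kn c v vc.
  have -> : ev v = (p.@[fun i => (c 0 i)%:~R])%:MP; last by rewrite p0.
  rewrite mevalE rmorph_sum; apply: eq_bigr => m _ /=.
  rewrite mpolyCM; congr (_ * _); rewrite rmorph_prod; apply: eq_bigr => i _ /=.
  by rewrite rmorphXn /= vc // rmorph_int.
pose i0 := Ordinal kn.
pose w (t : R) i := if i == i0 then t else v i.
pose q : {poly R} :=
  mmap (polyC \o @mpolyC n rat) (fun i => if i == i0 then 'X else (v i)%:P) p.
have qE t : q.[t] = ev (w t).
  rewrite -/(horner_eval t q) rmorph_sum; apply: eq_bigr => m _ /=.
  rewrite rmorphM /= /horner_eval hornerC; congr (_ * _).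
  rewrite -/(horner_eval t _) rmorph_prod; apply: eq_bigr => i _ /=.
  rewrite rmorphXn /= /horner_eval /w; congr (_ ^+ _).
  by case: eqP; rewrite ?hornerX ?hornerC.
have q0 : q = 0.
  apply/eqP/contraT => qn0.
  have := @max_poly_roots _ q [seq (j%:R : R) | j <- iota 0 (size q)] qn0.
  rewrite size_map size_iota ltnn; apply.
    apply/allP => _ /mapP [j _ ->]; rewrite /root qE; apply/eqP.
    apply: (IH (ltnW kn) (\row_i if i == i0 then j%:Z else c 0 i)) => i ki.
    rewrite mxE /w; case: eqP => [//|/eqP ne].
    apply: vc; rewrite ltn_neqAle ki andbT.
    by apply: contraNneq ne => e; apply/eqP/val_inj.
  rewrite map_inj_uniq ?iota_uniq // => i j.
  move=> /(congr1 (meval (fun=> 0 : rat))); rewrite !rmorph_nat => /eqP.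
  by rewrite eqr_nat => /eqP.
have -> : ev v = ev (w (v i0)).
  rewrite /ev /mmap; apply: eq_bigr => m _; congr (_ * _).
  by apply: mmap1_eq => i; rewrite /w; case: eqP => [->|].
by rewrite -qE q0 horner0.
Qed.

Lemma pval_inj (p q : polyfun L) : pval p =1 pval q -> p = q.
Proof.
move=> pq; apply/eqP; rewrite -subr_eq0; apply/eqP/mpoly_int_eq0 => c.
have [k _ kK] := coord_bij L.
have := pq (k c); rewrite /pval /ratcoord kK => /eqP.
by rewrite -subr_eq0 -mevalB => /eqP.
Qed.

Lemma diffact_dirderX_eq0 (u : L) (p : polyfun L) k :
  (msize p <= k)%N -> diffact (dirder u ^+ k) p = 0.
Proof.
have sz0 (q : polyfun L) j :
    reflect (forall m, (j <= mdeg m)%N -> q@_m = 0) (msize q <= j)%N.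
  apply: (iffP idP) => [le m jm|H].
    by apply: memN_msupp_eq0; apply: msize_mdeg_ge; apply: leq_trans jm.
  rewrite leqNgt; apply/negP => lt.
  have q0 : q != 0 by rewrite -msize_poly_eq0 -lt0n (leq_ltn_trans _ lt).
  have := mlead_supp q0; rewrite mcoeff_msupp H ?eqxx //.
  by rewrite -ltnS mlead_deg.
elim: k p => [|k IH] p le.
  have /eqP -> : p == 0 by rewrite -msize_poly_eq0 -leqn0.
  by rewrite expr0 diffact1.
rewrite exprSr -diffactA IH //; apply/sz0 => m km.
rewrite diffact_dirder raddf_sum big1 // => i _ /=.
rewrite mcoeffZ mcoeff_deriv (sz0 p k.+1 le) ?mul0rn ?mulr0 //.
by rewrite mdegD mdeg1 addn1.
Qed.

End PolynomialFunctions.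

Section ToddSeries.

(* (1 - exp (-x)) / x = \sum_k exp_quot k * x ^ k; since exp_quot 0 = 1 this
   series has an inverse, which is x / (1 - exp (-x)). *)
Definition exp_quot (k : nat) : rat := (-1) ^+ k / (k.+1)`!%:R.

Fixpoint todd_seq (n : nat) : seq rat :=
  if n is m.+1 then
    rcons (todd_seq m)
      ((m == 0%N)%:R - \sum_(i < m) (todd_seq m)`_i * exp_quot (m - i))
  else [::].

Definition todd (n : nat) : rat := (todd_seq n.+1)`_n.

Lemma size_todd_seq n : size (todd_seq n) = n.
Proof. by elim: n => //= n IH; rewrite size_rcons IH. Qed.

Lemma nth_todd_seq n i : (i < n)%N -> (todd_seq n)`_i = todd i.
Proof.
elim: n => // n IH; rewrite ltnS leq_eqVlt => /orP [/eqP -> //|lt].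
by rewrite /= nth_rcons size_todd_seq lt IH.
Qed.

Lemma todd_exp_quot n :
  \sum_(i < n.+1) todd i * exp_quot (n - i) = (n == 0%N)%:R.
Proof.
have e0 : exp_quot 0 = 1 by rewrite /exp_quot expr0 (_ : 1`! = 1%N) ?divr1.
rewrite big_ord_recr /= subnn e0 mulr1.
rewrite {2}/todd /= nth_rcons size_todd_seq ltnn eqxx addrC -addrA.
rewrite [X in - X](eq_bigr (fun i : 'I_n => todd i * exp_quot (n - i))).
  by rewrite addNr addr0.
by move=> i _; rewrite nth_todd_seq.
Qed.

Lemma toddP n :
  \sum_(i < n.+1) todd i *
    (((n - i)%N == 0%N)%:R - (-1) ^+ (n - i) / (n - i)`!%:R) = (n == 1%N)%:R.
Proof.
rewrite big_ord_recr /= subnn expr0 divr1 subrr mulr0 addr0.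
case: n => [|n]; first by rewrite big_ord0.
rewrite eqSS -todd_exp_quot; apply: eq_bigr => i _; congr (_ * _).
have lei : (i <= n)%N by rewrite -ltnS.
by rewrite subSn //= sub0r exprS mulN1r mulNr opprK.
Qed.

End ToddSeries.

Section RiemannRoch.
Variable L : lattice.
Implicit Types (f g : polyfun L) (u : L).

Definition Kring f : Type := annquot (f : shmod L).
HB.instance Definition _ f := GRing.ComPzRing.on (Kring f).

Definition Aring g : Type := annquot (g : diffmod L).
HB.instance Definition _ g := GRing.ComPzRing.on (Aring g).

Definition clsSh f (E : Sh L) : Kring f := acls (f : shmod L) E.
HB.instance Definition _ f := GRing.RMorphism.copy (clsSh f)
  (acls (f : shmod L)).

Definition clsDiff g (D : Diff L) : Aring g := acls (g : diffmod L) D.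
HB.instance Definition _ g := GRing.RMorphism.copy (clsDiff g)
  (acls (g : diffmod L)).

Definition clsT f u : Kring f := clsSh f (gU u).
Definition clsD g u : Aring g := clsDiff g (dirder u).

Lemma clsD_nilpotent g u : clsD g u ^+ msize g = 0.
Proof.
rewrite -rmorphXn -[RHS](rmorph0 (clsDiff g)).
by apply/acls_eq; rewrite scale0r; apply: diffact_dirderX_eq0.
Qed.

Definition Aact g (a : Aring g) : polyfun L := aact a.
HB.instance Definition _ g :=
  GRing.isZmodMorphism.Build (Aring g) (polyfun L) (@Aact g)
    (@aact_is_zmod_morphism _ _ (g : diffmod L)).

Lemma Aact_cls g D : Aact (clsDiff g D) = diffact D g.
Proof. exact: (aact_cls (g : diffmod L) D). Qed.

Definition QAact g (a : Qtensor (Aring g)) : polyfun L := Qext (@Aact g) a.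

Definition Kact f (k : Kring f) : polyfun L := aact k.

Lemma Kact_cls f E : Kact (clsSh f E) = shact E f.
Proof. exact: (aact_cls (f : shmod L) E). Qed.

Definition chiZ f (k : Kring f) : rat^o := pval (Kact k) 0.

Lemma chiZ_is_zmod_morphism f : zmod_morphism (@chiZ f).
Proof.
move=> k l; rewrite /chiZ /Kact.
by rewrite [aact _]aact_is_zmod_morphism /pval [LHS]mevalB.
Qed.

HB.instance Definition _ f :=
  GRing.isZmodMorphism.Build (Kring f) rat^o (@chiZ f)
    (@chiZ_is_zmod_morphism f).

Definition chi f (x : Qtensor (Kring f)) : rat := Qext (@chiZ f) x.

(* Units are spelled out because Kring f and Aring g may be the zero ring,
   which has no unitRingType structure. *)
Definition is_unit (R : comPzRingType) (x : R) : Prop := exists y, y * x = 1.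

Definition hom_to_units (V : zmodType) (R : comPzRingType) (phi : V -> R) :=
  (forall a, is_unit (phi a)) /\ {morph phi : a b / a + b >-> a * b}.

Definition is_todd_class f g (td : Qtensor (Aring g)) : Prop :=
  is_unit td /\ f = QAact td.

Definition riemann_roch_pair f g : Prop :=
  g \is homog mdeg /\ exists td : Qtensor (Aring g), is_todd_class f td.

(* By clsD_nilpotent the truncation at msize g is the full power series. *)
Definition is_todd_operator f g (Td : Kring f -> Qtensor (Aring g)) : Prop :=
  hom_to_units Td /\
  forall u, Td (clsT f u) =
    \sum_(k < msize g) todd k *: inQ (clsD g u) ^+ k.

Definition is_det_operator f (det : Kring f -> Kring f) : Prop :=
  hom_to_units det /\ forall u, det (clsT f u) = clsT f u.

Definition is_dualizing_morphism f (vee : {rmorphism Kring f -> Kring f}) :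
    Prop :=
  involutive vee /\ forall u, vee (clsT f u) = clsT f (- u).

Definition Qdual f (vee : {rmorphism Kring f -> Kring f}) :
    Qtensor (Kring f) -> Qtensor (Kring f) :=
  Qext (@inQ (Kring f) \o vee).

Definition is_dualizing_class f (d : nat)
    (vee : {rmorphism Kring f -> Kring f}) (omega : Qtensor (Kring f)) : Prop :=
  forall xi, chi xi = (-1) ^+ d * chi (omega * Qdual vee xi).

End RiemannRoch.

(* Main.v *)
(** Let [R] be the Q-algebra of [Aring g]. Sending [T^u] to [exp(d_u)] defines,
   by Taylor's formula, a ring morphism [chern] from [Sh L] to [R] such that
   [chern E] acts on [QDiff g] as [E] does. As [f = td g] with [td] a unit, [E]
   kills [f] iff [chern E = 0]; so [chern] induces an injection of the Q-algebra
   of [Kring f] into [R], which is onto because [d_u] is the logarithm of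
   [exp(d_u)]. On [R] there is the involution [sgn] induced by [d_u |-> - d_u],
   well defined because [g] is homogeneous, and it corresponds to the dualizing
   morphism. Writing [ev a = (a g)(0)], one has [chi xi = ev (chern xi td)] and
   [ev (sgn a) = (-1)^d ev a], and [ev (a b)] is a nondegenerate pairing, hence
   [omega] is a dualizing class iff [chern omega * td = sgn td]. Finally the
   identity [x / (1 - e^-x) = e^x (-x / (1 - e^x))] gives
   [Td x = chern (det x) Td (x^vee)] and [Td (x^vee) = sgn (Td x)], which is this
   equation for [td = Td (Omega^vee)] and [omega = det Omega]. *)
Require Import Defs.
From HB Require Import structures.
From mathcomp Require Import all_boot all_order all_algebra.
From mathcomp Require Import mpoly freeg.
From mathcomp Require Import ring.

Set Implicit Arguments.
Unset Strict Implicit.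
Unset Printing Implicit Defensive.

Import GRing.Theory.
Local Open Scope ring_scope.

(** * Power series at nilpotent elements of a rationalized ring *)

Section RationalScalars.
Variables (R : comPzRingType).
Implicit Types (x y : Qtensor R) (p q : {poly rat}).

Lemma qscaleAr (a : rat) x y : a *: (x * y) = x * (a *: y).
Proof. by rewrite mulrC qscaleAl mulrC. Qed.

Lemma Qtensor_frac x : exists n r, (0 < n)%N /\ x = n%:R^-1 *: inQ r.
Proof.
by have [r [n [n0 ->]]] := qfracP x; exists n, r; rewrite qfracE.
Qed.

(* {poly rat} has no evaluation at x in the library: Qtensor R may be the zero
   ring, hence is no algebra in the sense of the hierarchy. *)
Definition qeval x p : Qtensor R := \sum_(i < size p) p`_i *: x ^+ i.

Lemma qevalE n x p : (size p <= n)%N -> qeval x p = \sum_(i < n) p`_i *: x ^+ i.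
Proof.
move=> le; rewrite /qeval (big_ord_widen n (fun i => p`_i *: x ^+ i)) // big_mkcond.
apply: eq_bigr => i _; case: ltnP => // le'.
by rewrite nth_default // scale0r.
Qed.

Lemma qeval_is_zmod_morphism x : zmod_morphism (qeval x).
Proof.
move=> p q; pose n := maxn (size (p - q)) (maxn (size p) (size q)).
rewrite !(@qevalE n) ?leq_max ?leqnn ?orbT // -sumrB.
by apply: eq_bigr => i _; rewrite coefB scalerBl.
Qed.

HB.instance Definition _ x :=
  GRing.isZmodMorphism.Build {poly rat} (Qtensor R) (qeval x)
    (@qeval_is_zmod_morphism x).

Lemma qevalC x c : qeval x c%:P = c *: (1 : Qtensor R).
Proof.
by rewrite (@qevalE 1) ?size_polyC ?leq_b1 // big_ord1 coefC eqxx.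
Qed.

Lemma qevalMX x p : qeval x (p * 'X) = qeval x p * x.
Proof.
rewrite (@qevalE (size p).+1); last first.
  by apply: leq_trans (size_polyMleq _ _) _; rewrite size_polyX addnC.
rewrite big_ord_recl coefMX /= scale0r add0r mulr_suml; apply: eq_bigr => i _.
by rewrite coefMX /= -qscaleAl -exprSr.
Qed.

Lemma qevalCM x c p : qeval x (c%:P * p) = c *: qeval x p.
Proof.
elim/poly_ind: p => [|p a IH]; first by rewrite mulr0 raddf0 scaler0.
by rewrite mulrDr mulrA -polyCM !raddfD /= !qevalMX !qevalC IH qscaleAl scalerA.
Qed.

Lemma qevalM x p q : qeval x (p * q) = qeval x p * qeval x q.
Proof.
elim/poly_ind: p => [|p a IH]; first by rewrite mul0r raddf0 mul0r.
rewrite mulrDl mulrAC !raddfD /= !qevalMX IH qevalCM qevalC.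
by rewrite mulrDl -qscaleAl mul1r mulrAC.
Qed.

Lemma qeval1 x : qeval x 1 = 1.
Proof. by rewrite -[1 in LHS]/(1%:P) qevalC scale1r. Qed.

HB.instance Definition _ x :=
  GRing.isMonoidMorphism.Build {poly rat} (Qtensor R) (qeval x)
    (conj (qeval1 x) (qevalM x)).

Lemma qevalX x : qeval x 'X = x.
Proof. by rewrite -['X]mul1r qevalMX qeval1 mul1r. Qed.

Lemma qeval_poly x n (a : nat -> rat) :
  qeval x (\poly_(k < n) a k) = \sum_(k < n) a k *: x ^+ k.
Proof.
rewrite (qevalE x (size_poly _ _)); apply: eq_bigr => i _.
by rewrite coef_poly ltn_ord.
Qed.

(** Identities of power series thus hold at [x] once their coefficients agree below the order of
    nilpotency. *)
Lemma qeval_eq n x p q : x ^+ n = 0 ->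
  (forall i, (i < n)%N -> p`_i = q`_i) -> qeval x p = qeval x q.
Proof.
move=> x0 pq; pose m := maxn (size p) (size q).
rewrite !(@qevalE m) ?leq_max ?leqnn ?orbT //; apply: eq_bigr => i _.
case: (ltnP i n) => [/pq -> //|le].
by rewrite -(subnK le) exprD x0 mulr0 !scaler0.
Qed.

(** When [x ^+ n = 0], these three are the full values at [x] of the series [e^X], [X / (1 - e^-X)]
    and [(1 - e^-X) / X]. *)
Definition qexp n x : Qtensor R := \sum_(k < n) (k`!%:R^-1 : rat) *: x ^+ k.
Definition qtodd n x : Qtensor R := \sum_(k < n) todd k *: x ^+ k.
Definition qexp_quot n x : Qtensor R := \sum_(k < n) exp_quot k *: x ^+ k.

Lemma qevalNX x n (a : nat -> rat) :
  qeval x (\poly_(k < n) ((-1) ^+ k * a k)) = qeval (- x) (\poly_(k < n) a k).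
Proof.
rewrite !qeval_poly; apply: eq_bigr => i _.
rewrite (exprNn x) -(signr_odd rat) -(signr_odd (Qtensor R)).
by case: odd; rewrite ?expr0 ?expr1 ?mul1r // !mulN1r scaleNr scalerN.
Qed.

Lemma qtodd_exp_quot n x : x ^+ n = 0 -> qtodd n x * qexp_quot n x = 1.
Proof.
move=> x0; rewrite /qtodd /qexp_quot -!qeval_poly -rmorphM -(qeval1 x).
apply: (qeval_eq x0) => i lt; rewrite coefM coef1 -todd_exp_quot.
apply: eq_bigr => j _; rewrite !coef_poly.
by rewrite !(leq_ltn_trans _ lt) ?leq_subr // -ltnS.
Qed.

Lemma fact_neq0 n : n`!%:R != 0 :> rat.
Proof. by rewrite Num.Theory.pnatr_eq0 -lt0n fact_gt0. Qed.

(** As series, [e^X (1 - e^-X) / X = (e^X - 1) / X]. *)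
Lemma qexp_exp_quot n x : x ^+ n = 0 -> qexp n x * qexp_quot n x = qexp_quot n (- x).
Proof.
move=> x0; rewrite /qexp /qexp_quot -!qeval_poly -qevalNX.
rewrite -(qeval_poly x n (fun k => k`!%:R^-1)) -rmorphM.
apply: (qeval_eq x0) => i lt; rewrite coefM coef_poly lt /exp_quot.
rewrite mulrA -exprD addnn -signr_odd odd_double mul1r.
(* Up to sign and the factor [(i+1)!], the coefficient of [x^i] in the product is this binomial sum
   without its top term, which is 1. *)
have : (-1 + 1 : rat) ^+ i.+1 = 0 by rewrite addNr expr0n.
rewrite exprDn big_ord_recr /= subnn expr0 expr1n mulr1 binn mulr1n.
move=> /(canRL (addrK _)); rewrite sub0r => e.
apply: oppr_inj; rewrite -[RHS]mulN1r -[X in _ = X * _]e mulr_suml -sumrN.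
apply: eq_bigr => j _; rewrite !coef_poly.
have le : (j <= i)%N by rewrite -ltnS.
rewrite !(leq_ltn_trans _ lt) ?leq_subr // expr1n mulr1 subSn // exprS mulN1r.
rewrite -[_ *+ 'C(_, _)]mulr_natr -[in RHS](bin_fact (leqW le)) subSn // 2![in RHS]natrM.
have c0 : 'C(i.+1, j)%:R != 0 :> rat.
  by rewrite Num.Theory.pnatr_eq0 -lt0n bin_gt0 leqW.
move: (fact_neq0 j) (fact_neq0 (i - j).+1) c0.
move: j`!%:R (_.+1)`!%:R ('C(_, _)%:R) => a b c a0 b0 c0.
by field; rewrite a0 b0 c0.
Qed.

(** This is [qexp_exp_quot] with both quotients replaced by their inverses, the Todd series. *)
Lemma qtodd_opp n x : x ^+ n = 0 -> qtodd n x = qexp n x * qtodd n (- x).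
Proof.
move=> x0; have Nx0 : (- x) ^+ n = 0 by rewrite exprNn x0 mulr0.
rewrite -[LHS]mulr1 -(qtodd_exp_quot Nx0) -(qexp_exp_quot x0).
rewrite -[RHS]mul1r -(qtodd_exp_quot x0).
by move: (qtodd n x) (qtodd n _) (qexp n x) (qexp_quot n x) => a b c e; ring.
Qed.

(** A subalgebra [S] containing [e^x] contains the logarithm [x]. The powers of [e^x - 1] are
    triangular in those of [x], so no logarithm series is written down. *)
Lemma mem_of_qexp n x (S : Qtensor R -> Prop) :
    S 1 -> (forall a y, S y -> S (a *: y)) ->
    (forall y z, S y -> S z -> S (y + z)) ->
    (forall y z, S y -> S z -> S (y * z)) ->
  x ^+ n = 0 -> S (qexp n x) -> S x.
Proof.
move=> S1 SZ SD SM.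
have S0 : S 0 by rewrite -(scale0r (1 : Qtensor R)); apply: SZ.
(* For [n] at most 1 the truncated exponential has no linear term, but then [x = 0]. *)
case: n => [|[|n]] x0 Se.
- by rewrite -[x]mulr1 -(expr0 x) x0 mulr0.
- by rewrite -[x]expr1 x0.
pose v := \poly_(k < n) ((k.+2)`!%:R^-1 : rat).
have e1 : qexp n.+2 x - 1 = x * qeval x (1 + 'X * v).
  rewrite /qexp !big_ord_recl !invr1 !scale1r expr0 expr1 addrC addKr.
  rewrite rmorphD rmorphM /= qevalX qeval1 mulrDr mulr1; congr (_ + _).
  rewrite mulrA qeval_poly mulr_sumr; apply: eq_bigr => i _.
  by rewrite -qscaleAr -mulrA -!exprS.
have Xj j : exists s, (1 + 'X * v) ^+ j = 1 + 'X * s.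
  elim: j => [|j [s e]]; first by exists 0; rewrite mulr0 addr0.
  by exists (v + s + v * 'X * s); rewrite exprS e; ring.
(* Descending induction on j: [(exp x - 1) ^ j] is [x ^ j] plus higher powers. *)
suff : forall k j, (0 < j)%N -> (n.+2 <= j + k)%N -> S (x ^+ j).
  by move=> /(_ n.+1 1%N isT (leqnn _)); rewrite expr1.
elim=> [|k IH] j j0 le.
  by rewrite addn0 in le; rewrite -(subnK le) exprD x0 mulr0.
have [s es] := Xj j.
have : (qexp n.+2 x - 1) ^+ j = x ^+ j + qeval x s * x ^+ j.+1.
  rewrite e1 exprMn_comm; last exact: mulrC.
  rewrite -rmorphXn es rmorphD rmorphM /= qevalX qeval1 exprS; ring.
move=> /(canLR (addrK _)) <-; apply: (SD).
  have Se1 : S (qexp n.+2 x - 1).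
    by apply: (SD) => //; rewrite -scaleN1r; apply: SZ.
  by elim: j {j0 le es} => [|j IHj]; rewrite ?expr0 // exprS; apply: SM.
rewrite -scaleN1r /qeval mulr_suml; apply: (SZ); apply: (big_ind S) => //.
move=> i _; rewrite -qscaleAl -exprD; apply/SZ/IH; rewrite addnS //.
by rewrite addSn -addnS -addnA (leq_trans le) ?leq_addl.
Qed.

End RationalScalars.

(** * Extension of additive maps and ring morphisms to rational coefficients *)

Section RationalExtension.
Variable R : comPzRingType.

Lemma Qext_eq0 (V : lmodType rat) (phi : {additive R -> V}) x :
  (forall r, phi r = 0 -> r = 0) -> Qext phi x = 0 -> x = 0.
Proof.
move=> inj; have [n [r [n0 ->]]] := Qtensor_frac x.
rewrite -qfracE // Qext_frac // qfracE // => /(congr1 ( *:%R (n%:R : rat))).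
rewrite scaler0 scalerA mulfV ?scale1r ?Num.Theory.pnatr_eq0 -?lt0n // => /inj ->.
by rewrite raddf0.
Qed.

HB.instance Definition _ (V : lmodType rat) (phi : {additive R -> V}) :=
  GRing.isLinear.Build rat (Qtensor R) V *:%R (Qext phi) (Qext_is_linear phi).

Lemma Qext_is_monoid_morphism (R' : comPzRingType)
  (phi : {rmorphism R -> Qtensor R'}) : monoid_morphism (Qext phi).
Proof.
split=> [|x y]; first exact: etrans (Qext_inQ phi 1) (rmorph1 phi).
have [n [r [_ ->]]] := Qtensor_frac x; have [m [s [_ ->]]] := Qtensor_frac y.
rewrite -qscaleAl -qscaleAr -rmorphM !linearZ /= !(Qext_inQ phi) /= rmorphM.
by rewrite -qscaleAl -qscaleAr.
Qed.

HB.instance Definition _ (R' : comPzRingType)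
    (phi : {rmorphism R -> Qtensor R'}) :=
  GRing.isMonoidMorphism.Build (Qtensor R) (Qtensor R') (Qext phi)
    (Qext_is_monoid_morphism phi).

End RationalExtension.

(** The classes of the [T^u] generate the additive group of [Kring f], and values in units force
    [h 0 = 1] and [h (- a) = (h a)^-1]. Identities between Todd operators and determinants are
    checked on the [T^u] in this way. *)
Lemma hom_to_units_eq (L : lattice) (f : polyfun L) (R : comPzRingType)
    (phi psi : Kring f -> R) : hom_to_units phi -> hom_to_units psi ->
  (forall u, phi (clsT f u) = psi (clsT f u)) -> phi =1 psi.
Proof.
move=> [phiU phiD] [psiU psiD] e.
have h0 (h : Kring f -> R) : (forall a, is_unit (h a)) ->
    {morph h : a b / a + b >-> a * b} -> h 0 = 1.
  move=> hU hD; have [y yh] := hU 0.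
  by rewrite -[h 0]mul1r -yh -mulrA -hD addr0 yh.
have hN (h : Kring f -> R) : (forall a, is_unit (h a)) ->
    {morph h : a b / a + b >-> a * b} -> forall a, h (- a) * h a = 1.
  by move=> hU hD a; rewrite -hD addNr h0.
move=> x; have [E ->] := aclsP x; rewrite -/(clsSh f E).
elim/gr_ind: E => [|u|E IH|E F IHE IHF]; rewrite ?raddf0 ?raddfN ?raddfD.
- by rewrite !h0.
- exact: e.
- by rewrite -[LHS]mulr1 -(hN _ psiU psiD (clsSh f E)) -IH mulrCA (hN _ phiU phiD) mulr1.
- by rewrite phiD psiD IHE IHF.
Qed.

(** * The sign change of the variables *)

Section Flip.
Variables (n : nat) (R : comNzRingType).
Implicit Types (p : {mpoly R[n]}).

(** On polynomial functions this is the pullback along [x |-> - x]; on [Diff L] it negates every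
    partial derivative. *)
Definition flip p : {mpoly R[n]} := mmap (@mpolyC n R) (fun i => - 'X_i) p.
HB.instance Definition _ := GRing.RMorphism.copy flip
  (mmap (@mpolyC n R) (fun i => - 'X_i)).

Lemma flipX m : flip 'X_[m] = (-1) ^+ mdeg m *: 'X_[m].
Proof.
rewrite /flip mmapX /mmap1 mpolyXE_id mdegE -mul_mpolyC rmorphXn rmorphN1.
rewrite -prodrXr -big_split; apply: eq_bigr => i _ /=.
by rewrite exprNn.
Qed.

Lemma flipZ c p : flip (c *: p) = c *: flip p.
Proof. by rewrite /flip mmapZ mul_mpolyC. Qed.

Lemma mcoeff_flip p m : (flip p)@_m = (-1) ^+ mdeg m * p@_m.
Proof.
elim/mpolyind: p => [|c k p _ _ IH]; first by rewrite raddf0 mcoeff0 mulr0.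
rewrite raddfD /= !mcoeffD IH mulrDr flipZ flipX !mcoeffZ mcoeffX; congr (_ + _).
by case: eqP => [->|]; rewrite ?mulr0 // !mulr1 mulrC.
Qed.

Lemma flipK : involutive flip.
Proof.
move=> p; apply/mpolyP => m.
by rewrite !mcoeff_flip mulrA -exprD addnn -signr_odd odd_double mul1r.
Qed.

Lemma flip_homog p : p \is homog mdeg -> flip p = (-1) ^+ (msize p).-1 *: p.
Proof.
move=> /dhomogP hp; apply/mpolyP => m; rewrite mcoeff_flip mcoeffZ.
case: (boolP (m \in msupp p)) => [/hp -> //|/memN_msupp_eq0 ->].
by rewrite !mulr0.
Qed.

End Flip.

Arguments flip {n R} p.

(** * Reflection and differential operators *)

Section DifferentialOperators.
Variable L : lattice.
Implicit Types (p : polyfun L) (D : Diff L) (u x : L).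

Lemma pval_flip p x : pval (flip p) x = pval p (- x).
Proof.
rewrite /pval.
elim/mpolyind: p => [|c m p _ _ IH]; first by rewrite !raddf0.
rewrite !raddfD /= -IH flipZ flipX !mevalZ !mevalX mdegE -prodrXr.
congr (_ * _ + _); rewrite -big_split; apply: eq_bigr => i _ /=.
by rewrite /ratcoord raddfN mxE mulrNz -exprNn.
Qed.

Lemma flip_dirder u : flip (dirder u) = dirder (- u).
Proof.
rewrite raddf_sum; apply: eq_bigr => i _ /=.
by rewrite raddfMz /= /flip mmapX mmap1U raddfN mxE mulrNz mulNrz.
Qed.

Lemma dirderN u : dirder (- u) = - dirder u.
Proof.
by rewrite -sumrN; apply: eq_bigr => i _; rewrite raddfN mxE mulrNz.
Qed.

Lemma mderivm_flip m p : (flip p)^`M[m] = (-1) ^+ mdeg m *: flip (p^`M[m]).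
Proof.
apply/mpolyP => k; rewrite mcoeffZ mcoeff_flip !mcoeff_mderivm mcoeff_flip.
by rewrite mdegD exprD -mulrnAr mulrA.
Qed.

Lemma diffactZ (c : int) D p : diffact (c *: D) p = diffact D p *~ c.
Proof.
by rewrite -[c in LHS]intz scaler_int; exact: (raddfMz (diffact_to p)).
Qed.

(** For a monomial operator of order [k], the sign [(-1)^k] from flipping it cancels the one that
    the chain rule produces on [flip p]. *)
Lemma diffact_flip D p : diffact (flip D) (flip p) = flip (diffact D p).
Proof.
elim/mpolyind: D => [|c m D _ _ IH].
  by rewrite raddf0 -![diffact 0 _]/(diffact_to _ _) !raddf0.
rewrite raddfD /= !diffactDl raddfD /= IH; congr (_ + _).
rewrite flipZ flipX !diffactZ !diffactX raddfMz mderivm_flip /=; congr (_ *~ _).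
by rewrite -scaler_int scalerA rmorphXn rmorphN1 -exprMn mulrNN mulr1 expr1n scale1r.
Qed.

(** * Taylor's formula *)

Section Taylor.
Variables u x : L.

(* The restriction of p to the line [t |-> x + t u] *)
Definition along p : {poly rat} :=
  mmap (@polyC rat) (fun i => (ratcoord x i)%:P + ratcoord u i *: 'X) p.
HB.instance Definition _ := GRing.RMorphism.copy along
  (mmap (@polyC rat) (fun i => (ratcoord x i)%:P + ratcoord u i *: 'X)).

Lemma horner_along p t :
  (along p).[t] = p.@[fun i => ratcoord x i + ratcoord u i * t].
Proof.
rewrite -/(horner_eval t _) mevalE [along p]/mmap rmorph_sum; apply: eq_bigr => m _ /=.
rewrite rmorphM /= /horner_eval hornerC; congr (_ * _).
rewrite -/(horner_eval t _) rmorph_prod; apply: eq_bigr => i _ /=.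
by rewrite rmorphXn /= /horner_eval !hornerE.
Qed.

(** The chain rule on the line. Both sides obey the Leibniz rule, so constants and coordinates
    suffice. *)
Lemma deriv_along p : (along p)^`() = along (diffact (dirder u) p).
Proof.
pose P p := (along p)^`() = along (diffact (dirder u) p).
have dM q r : diffact (dirder u) (q * r) =
    diffact (dirder u) q * r + q * diffact (dirder u) r.
  rewrite !diffact_dirder mulr_suml mulr_sumr -big_split; apply: eq_bigr => i _.
  by rewrite mderivM scalerDr -scalerAl -scalerAr.
have PM q r : P q -> P r -> P (q * r).
  by move=> Pq Pr; rewrite /P dM rmorphM derivM raddfD /= !rmorphM /= Pq Pr.
have PD q r : P q -> P r -> P (q + r).
  by move=> Pq Pr; rewrite /P diffactDr !raddfD /= Pq Pr.
have PC c : P c%:MP.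
  rewrite /P {1}/along mmapC derivC diffact_dirder big1 ?raddf0 // => i _.
  by rewrite mderivC scaler0.
have UUi0 (i : 'I_(rank L)) : (U_(i) - U_(i))%MM = 0%MM.
  by apply/mnmP=> j; rewrite mnmBE mnm0E subnn.
have PX i : P 'X_i.
  rewrite /P {1}/along mmapX mmap1U derivD derivC add0r derivZ derivX.
  rewrite diffact_dirder (bigD1 i) //= big1 ?addr0.
    by rewrite mderivX mnm1E eqxx UUi0 mpolyX0 scale1r
      -mul_mpolyC rmorphM rmorph1 /= {1}/along mmapC -mul_polyC.
  by move=> j ne; rewrite mderivX mnm1E eq_sym (negbTE ne) scale0r scaler0.
rewrite -/(P p); elim/mpolyind: p => [|c m p _ _ IH]; first exact: (PC 0).
apply: (PD) => //; rewrite -mul_mpolyC; apply: (PM); first exact: PC.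
rewrite mpolyXE_id; apply: big_ind => // [|i _]; first exact: (PC 1).
by elim: (m i) => [|k IHk]; [exact: (PC 1)|rewrite exprS; apply: PM].
Qed.

Lemma derivn_along p k : (along p)^`(k) = along (diffact (dirder u ^+ k) p).
Proof.
elim: k => [|k IH]; first by rewrite expr0 diffact1.
by rewrite derivnS IH deriv_along diffactA -exprS.
Qed.

Lemma pval_taylor p :
  pval p (x + u) =
  \sum_(k < msize p) k`!%:R^-1 * pval (diffact (dirder u ^+ k) p) x.
Proof.
have nE k : (along p)^`N(k).[0] = k`!%:R^-1 * pval (diffact (dirder u ^+ k) p) x.
  have -> : pval (diffact (dirder u ^+ k) p) x = (along p)^`(k).[0].
    rewrite derivn_along horner_along; apply: meval_eq => i.
    by rewrite mulr0 addr0.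
  rewrite nderivn_def hornerMn mulrnAr -mulrnAl -[_^-1 *+ _]mulr_natr mulVf ?mul1r //.
  by rewrite Num.Theory.pnatr_eq0 -lt0n fact_gt0.
have -> : pval p (x + u) = (along p).[0 + 1].
  by rewrite horner_along; apply: meval_eq => i; rewrite add0r mulr1 ratcoordD.
(* The sum of the two sizes is a common bound for both expansions; the terms from [msize p] on
   vanish. *)
rewrite (nderiv_taylor_wide (mulrC _ _) (leq_addr (msize p) _)).
rewrite [RHS](big_ord_widen (size (along p) + msize p)
  (fun k => k`!%:R^-1 * pval (diffact (dirder u ^+ k) p) x)) ?leq_addl //.
rewrite [RHS]big_mkcond; apply: eq_bigr => k _; rewrite expr1n mulr1 nE.
by case: ltnP => // le; rewrite diffact_dirderX_eq0 // /pval meval0 mulr0.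
Qed.

End Taylor.

Lemma shift_taylor u p : shift u p =
  \sum_(k < msize p) (k`!%:R^-1 : rat) *: diffact (dirder u ^+ k) p.
Proof.
apply: pval_inj => x; rewrite pval_shift pval_taylor /pval raddf_sum.
by apply: eq_bigr => k _; rewrite /= mevalZ.
Qed.

Lemma shiftZ (a : rat) u p : shift u (a *: p) = a *: shift u p.
Proof. by rewrite /shift comp_mpolyZ. Qed.

Lemma shift_taylorw n u p : (msize p <= n)%N -> shift u p =
  \sum_(k < n) (k`!%:R^-1 : rat) *: diffact (dirder u ^+ k) p.
Proof.
move=> le; rewrite shift_taylor (big_ord_widen n
  (fun k => (k`!%:R^-1 : rat) *: diffact (dirder u ^+ k) p)) // big_mkcond.
apply: eq_bigr => k _; case: ltnP => // ?.
by rewrite diffact_dirderX_eq0 ?scaler0.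
Qed.

Lemma diffactZr (a : rat) D p : diffact D (a *: p) = a *: diffact D p.
Proof.
rewrite /diffact scaler_sumr; apply: eq_bigr => m _.
by rewrite linearZ -!scaler_int !scalerA mulrC.
Qed.

Lemma diffact0 D : diffact D 0 = 0 :> polyfun L.
Proof. by rewrite -[0 in LHS](scale0r 0) diffactZr scale0r. Qed.

(** By Taylor's formula a shift is a series in one derivation, and operators with constant
    coefficients commute. *)
Lemma shift_diffact u D p : shift u (diffact D p) = diffact D (shift u p).
Proof.
rewrite (@shift_taylorw (msize (diffact D p) + msize p)) ?leq_addr //.
rewrite (@shift_taylorw (msize (diffact D p) + msize p) _ p) ?leq_addl //.
rewrite (big_morph (diffact D) (@diffactDr L D) (diffact0 D)).
by apply: eq_bigr => k _; rewrite diffactZr !diffactA mulrC.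
Qed.

End DifferentialOperators.

(** * Ring morphisms out of a quotient by an annihilator *)

Section AnnihilatorLift.
Variables (S R : comPzRingType) (M : lmodType S) (m : M).
Variable (h : {rmorphism S -> R}).
Hypothesis hm : forall a, a *: m = 0 -> h a = 0.

(** The morphism induced by [h] on the quotient. The proof is an argument, so that the term
    [alift hm] can carry the structure of a ring morphism. *)
Definition alift of (forall a, a *: m = 0 -> h a = 0) :=
  fun x : annquot m => h (repr x).

Lemma alift_cls a : alift hm (acls m a) = h a.
Proof.
apply/eqP; rewrite /alift -subr_eq0 -raddfB; apply/eqP/hm.
by rewrite scalerBl repr_acls subrr.
Qed.

Lemma alift_is_zmod_morphism : zmod_morphism (alift hm).
Proof.
move=> x y; have [a ->] := aclsP x; have [b ->] := aclsP y.
by rewrite -raddfB !alift_cls raddfB.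
Qed.

Lemma alift_is_monoid_morphism : monoid_morphism (alift hm).
Proof.
split=> [|x y]; first by rewrite -(rmorph1 (acls m)) alift_cls rmorph1.
have [a ->] := aclsP x; have [b ->] := aclsP y.
by rewrite -rmorphM !alift_cls rmorphM.
Qed.

HB.instance Definition _ :=
  GRing.isZmodMorphism.Build (annquot m) R (alift hm) alift_is_zmod_morphism.
HB.instance Definition _ :=
  GRing.isMonoidMorphism.Build (annquot m) R (alift hm) alift_is_monoid_morphism.

End AnnihilatorLift.

Arguments alift : simpl never.

(** * The inversion of the group ring, which lifts the dualizing morphism *)

Section GroupRingInversion.
Variable V : zmodType.

Definition ginv : groupring V -> groupring V := glift (fun u => gU (- u)).
HB.instance Definition _ := GRing.isZmodMorphism.Build
  (groupring V) (groupring V) ginv (glift_is_zmod_morphism (fun u => gU (- u))).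

Lemma ginvU u : ginv (gU u) = gU (- u).
Proof. exact: gliftU. Qed.

Lemma ginv_is_monoid_morphism : monoid_morphism ginv.
Proof.
split=> [|E F]; first by rewrite -gU0 ginvU oppr0.
elim/gr_ind: E => [|u|E IH|E1 E2 IH1 IH2].
- by rewrite mul0r raddf0 mul0r.
- elim/gr_ind: F => [|v|F IH|F1 F2 IH1 IH2].
  + by rewrite mulr0 raddf0 mulr0.
  + by rewrite -gUD !ginvU opprD gUD.
  + by rewrite mulrN !raddfN /= IH mulrN.
  + by rewrite mulrDr !raddfD /= IH1 IH2 mulrDr.
- by rewrite mulNr !raddfN /= IH mulNr.
- by rewrite mulrDl !raddfD /= IH1 IH2 mulrDl.
Qed.
HB.instance Definition _ :=
  GRing.isMonoidMorphism.Build (groupring V) (groupring V) ginv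
    ginv_is_monoid_morphism.

Lemma ginvK : involutive ginv.
Proof.
elim/gr_ind=> [|u|E IH|E F IHE IHF]; first by rewrite !raddf0.
- by rewrite !ginvU opprK.
- by rewrite raddfN /= raddfN /= IH.
- by rewrite raddfD /= raddfD /= IHE IHF.
Qed.

End GroupRingInversion.

(** * The rationalized ring of [g] and the Chern character *)

Section DifferentialRing.
Variables (L : lattice) (g : polyfun L).
Local Notation R := (Qtensor (Aring g)).
Local Notation x u := (inQ (clsD g u) : R).
Implicit Types (a b : R) (u v : L) (E F : Sh L) (D : Diff L).

HB.instance Definition _ := GRing.Linear.copy (@QAact L g) (Qext (@Aact L g)).

Lemma QAact_cls D : QAact (inQ (clsDiff g D)) = diffact D g.
Proof. by rewrite /QAact Qext_inQ /= Aact_cls. Qed.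

(** Exactly the operators killing [g] were divided out, and denominators can be cleared. Equations
    in the ring may thus be tested on polynomials. *)
Lemma QAact_inj : injective (@QAact L g).
Proof.
move=> a b ab; apply/eqP; rewrite -subr_eq0; apply/eqP.
have : QAact (a - b) = 0 by rewrite raddfB /= ab subrr.
apply: Qext_eq0 => k; have [D ->] : exists D, k = clsDiff g D := aclsP k.
rewrite /= Aact_cls => e.
by rewrite -(rmorph0 (clsDiff g)); apply/acls_eq; rewrite scale0r.
Qed.

Lemma QA_frac a : exists n D, (0 < n)%N /\ a = n%:R^-1 *: inQ (clsDiff g D).
Proof.
have [n [k [n0 ->]]] := Qtensor_frac a.
have [D ->] : exists D, k = clsDiff g D := aclsP k.
by exists n, D.
Qed.

Lemma QAact_diff D a : QAact (inQ (clsDiff g D) * a) = diffact D (QAact a).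
Proof.
have [n [D' [_ ->]]] := QA_frac a.
by rewrite -qscaleAr -rmorphM -rmorphM !linearZ /= !QAact_cls diffactZr diffactA.
Qed.

Lemma clsDN u : clsD g (- u) = - clsD g u.
Proof. by rewrite /clsD dirderN raddfN. Qed.

Lemma inQ_clsD_nilpotent u : x u ^+ msize g = 0.
Proof. by rewrite -rmorphXn clsD_nilpotent rmorph0. Qed.

Lemma QAact_exp u a : QAact (qexp (msize g) (x u) * a) = shift u (QAact a).
Proof.
have [n [D [_ ->]]] := QA_frac a.
rewrite -qscaleAr mulrC !linearZ /= QAact_diff QAact_cls shiftZ shift_diffact.
congr (_ *: diffact _ _); rewrite shift_taylor linear_sum; apply: eq_bigr => k _.
by rewrite linearZ /= -!rmorphXn QAact_cls.
Qed.

Definition chern E : R := glift (fun u => qexp (msize g) (x u)) E.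
HB.instance Definition _ := GRing.isZmodMorphism.Build (Sh L) R chern
  (glift_is_zmod_morphism (fun u => qexp (msize g) (x u))).

Lemma chernU u : chern (gU u) = qexp (msize g) (x u).
Proof. exact: gliftU. Qed.

Lemma QAact_chern E a : QAact (chern E * a) = shact E (QAact a).
Proof.
elim/gr_ind: E => [|u|E IH|E F IHE IHF].
- by rewrite raddf0 mul0r raddf0 /shact raddf0.
- by rewrite chernU QAact_exp shactU.
- by rewrite shactN !(raddfN, mulNr) /= IH.
- by rewrite shactDl !(raddfD, mulrDl) /= IHE IHF.
Qed.

(** In place of the functional equation of the exponential: the action on [g] is faithful, and
    shifts compose. *)
Lemma chern_is_monoid_morphism : monoid_morphism chern.
Proof.
split=> [|E F]; apply: QAact_inj.
  by rewrite -[chern 1]mulr1 QAact_chern shact1.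
by rewrite -[chern (E * F)]mulr1 -[chern F]mulr1 !QAact_chern shactA.
Qed.
HB.instance Definition _ :=
  GRing.isMonoidMorphism.Build (Sh L) R chern chern_is_monoid_morphism.

(** By [mem_of_qexp], a subalgebra containing every [e^(d_u)] contains every [d_u], in particular
    the partial derivatives, which generate [R]. *)
Lemma chern_generates (S : R -> Prop) : S 1 -> (forall c y, S y -> S (c *: y)) ->
  (forall y z, S y -> S z -> S (y + z)) -> (forall y z, S y -> S z -> S (y * z)) ->
  (forall E, S (chern E)) -> forall a, S a.
Proof.
move=> S1 SZ SD SM SE a; have [n [D [_ ->]]] := QA_frac a; apply: (SZ).
have S0 : S 0 by rewrite -(scale0r (1 : R)); apply: (SZ).
elim/mpolyind: D => [|c m D _ _ IH]; first by rewrite !raddf0.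
rewrite !raddfD /=; apply: (SD) => //.
rewrite -[c]intz scaler_int !raddfMz -scaler_int; apply: (SZ).
rewrite mpolyXE_id /= !rmorph_prod; apply: (big_ind S) => // i _.
have [k _ kK] := coord_bij L.
(* The [i]-th partial derivative is taken along the [i]-th basis vector of the lattice, found by
   inverting the coordinates. *)
have <- : dirder (k (delta_mx 0 i)) = 'X_i.
  rewrite /dirder (bigD1 i) //= big1 ?addr0 => [|j ne]; first by rewrite kK mxE !eqxx.
  by rewrite kK mxE (negbTE ne) andbF.
rewrite !rmorphXn /= -/(clsD g _).
elim: (m i) => [|j IHj]; rewrite ?expr0 // exprS; apply: (SM) => //.
apply: (mem_of_qexp S1 SZ SD SM (inQ_clsD_nilpotent _)).
by rewrite -chernU.
Qed.

Definition evalat0 a : rat := pval (QAact a) 0.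

Lemma evalat0_chern E a : evalat0 (chern E * a) = pval (shact E (QAact a)) 0.
Proof. by rewrite /evalat0 QAact_chern. Qed.

(** Taking [E = T^u] reads off the value of [a g] at [u], and a polynomial function vanishing on the
    whole lattice is zero. *)
Lemma evalat0_eq0 a : (forall E, evalat0 (chern E * a) = 0) -> a = 0.
Proof.
move=> h; apply: QAact_inj; apply: pval_inj => u; rewrite raddf0 {2}/pval meval0.
by rewrite -[u]add0r -pval_shift -shactU -evalat0_chern h.
Qed.

End DifferentialRing.

(** * The sign involution for homogeneous [g] *)

Section SignInvolution.
Variables (L : lattice) (g : polyfun L).
Hypothesis hg : g \is homog mdeg.
Local Notation R := (Qtensor (Aring g)).
Local Notation d := (msize g).-1.
Implicit Types (a b : R) (u : L) (E : Sh L) (D : Diff L).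

(** Homogeneity gives [flip g = (-1)^d g]. Consequently [flip] preserves the annihilator of [g]. *)
Lemma diffact_flip_homog D :
  diffact (flip D) g = (-1) ^+ d *: flip (diffact D g).
Proof.
rewrite -diffact_flip (flip_homog hg) diffactZr scalerA -exprD addnn.
by rewrite -signr_odd odd_double scale1r.
Qed.

Lemma clsDiff_flip_eq0 D : D *: (g : diffmod L) = 0 -> (clsDiff g \o flip) D = 0.
Proof.
move=> Dg; rewrite -(rmorph0 (clsDiff g)); apply/acls_eq; rewrite scale0r.
by rewrite [LHS]diffact_flip_homog [diffact D g]Dg raddf0 scaler0.
Qed.

Definition sgn : R -> R := Qext (@inQ (Aring g) \o alift clsDiff_flip_eq0).
HB.instance Definition _ := GRing.Linear.on sgn.
HB.instance Definition _ := GRing.RMorphism.on sgn.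

Lemma sgn_cls D : sgn (inQ (clsDiff g D)) = inQ (clsDiff g (flip D)).
Proof.
rewrite /sgn Qext_inQ; apply: (congr1 (@inQ (Aring g))).
exact: (alift_cls clsDiff_flip_eq0 D).
Qed.

Lemma sgnK : involutive sgn.
Proof.
by move=> a; have [n [D [_ ->]]] := QA_frac a; rewrite !linearZ /= !sgn_cls flipK.
Qed.

Lemma sgn_clsD u : sgn (inQ (clsD g u)) = - inQ (clsD g u).
Proof. by rewrite sgn_cls flip_dirder -[inQ _]/(inQ (clsD g _)) clsDN raddfN. Qed.

Lemma QAact_sgn a : QAact (sgn a) = (-1) ^+ d *: flip (QAact a).
Proof.
have [n [D [_ ->]]] := QA_frac a.
rewrite !linearZ /= sgn_cls !QAact_cls diffact_flip_homog flipZ.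
by rewrite !scalerA mulrC.
Qed.

Lemma evalat0_sgn a : evalat0 (sgn a) = (-1) ^+ d * evalat0 a.
Proof.
by rewrite /evalat0 QAact_sgn {1}/pval mevalZ -/(pval _ 0) pval_flip oppr0.
Qed.

Lemma chern_ginv E : chern g (ginv E) = sgn (chern g E).
Proof.
elim/gr_ind: E => [|u|E IH|E F IHE IHF].
- by rewrite !raddf0.
- rewrite ginvU !chernU linear_sum; apply: eq_bigr => k _.
  by rewrite linearZ /= rmorphXn /= sgn_clsD clsDN raddfN.
- by rewrite !raddfN /= IH.
- by rewrite !raddfD /= IHE IHF.
Qed.

(** * Comparison of the two rings through a Todd class *)

Section ToddClass.
Variables (f : polyfun L) (td : R).
Hypothesis htd : is_todd_class f td.

(** Since [E f] is the action of [chern E * td] on [g], faithfulness and the inverse of [td] give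
    the equivalence. *)
Lemma todd_shact_eq0 E : shact E f = 0 <-> chern g E = 0.
Proof.
have [[t tK] ->] := htd; rewrite -QAact_chern; split=> [|->]; last first.
  by rewrite mul0r raddf0.
move=> e; have td0 : chern g E * td = 0 by apply: QAact_inj; rewrite e raddf0.
by rewrite -[LHS]mulr1 -tK mulrCA td0 mulr0.
Qed.

Lemma chern_eq0 E : E *: (f : shmod L) = 0 -> chern g E = 0.
Proof. by move=> /todd_shact_eq0. Qed.

(** Inversion preserves the annihilator of [f], because that is the kernel of [chern] and inversion
    becomes [sgn] there. *)
Lemma clsSh_ginv_eq0 E : E *: (f : shmod L) = 0 -> (clsSh f \o @ginv L) E = 0.
Proof.
move=> /todd_shact_eq0 E0; rewrite -(rmorph0 (clsSh f)); apply/acls_eq.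
by rewrite scale0r; apply/todd_shact_eq0; rewrite chern_ginv E0 raddf0.
Qed.

Lemma dualizing_morphism_exists :
  exists vee : {rmorphism Kring f -> Kring f}, is_dualizing_morphism vee.
Proof.
have veeE E : alift clsSh_ginv_eq0 (clsSh f E) = clsSh f (ginv E).
  exact: alift_cls.
exists (alift clsSh_ginv_eq0); split=> [k|u]; last by rewrite /= veeE ginvU.
have [E ->] : exists E, k = clsSh f E := aclsP k.
by rewrite /= !veeE ginvK.
Qed.

Definition Kchern : Kring f -> R := alift chern_eq0.
HB.instance Definition _ := GRing.RMorphism.on Kchern.

Lemma Kchern_cls E : Kchern (clsSh f E) = chern g E.
Proof. exact: alift_cls. Qed.

Definition QKchern : Qtensor (Kring f) -> R := Qext Kchern.
HB.instance Definition _ := GRing.Linear.on QKchern.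
HB.instance Definition _ := GRing.RMorphism.on QKchern.

Lemma QK_frac xi : exists n E, (0 < n)%N /\ xi = n%:R^-1 *: inQ (clsSh f E).
Proof.
have [n [k [n0 ->]]] := Qtensor_frac xi.
have [E ->] : exists E, k = clsSh f E := aclsP k.
by exists n, E.
Qed.

Lemma QKchern_inQ k : QKchern (inQ k) = Kchern k.
Proof. exact: Qext_inQ. Qed.

Lemma QKchern_inj : injective QKchern.
Proof.
move=> a b ab; apply/eqP; rewrite -subr_eq0; apply/eqP.
have : QKchern (a - b) = 0 by rewrite raddfB /= ab subrr.
apply: Qext_eq0 => k; have [E ->] : exists E, k = clsSh f E := aclsP k.
rewrite /= Kchern_cls => /todd_shact_eq0 E0.
by rewrite -(rmorph0 (clsSh f)); apply/acls_eq; rewrite scale0r.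
Qed.

Lemma QKchern_surj a : exists xi, QKchern xi = a.
Proof.
elim/(@chern_generates _ g): a => [|c _ [y <-]|_ _ [y <-] [z <-]|_ _ [y <-] [z <-]|E].
- by exists 1; rewrite rmorph1.
- by exists (c *: y); rewrite linearZ.
- by exists (y + z); rewrite raddfD.
- by exists (y * z); rewrite rmorphM.
- by exists (inQ (clsSh f E)); rewrite QKchern_inQ Kchern_cls.
Qed.

Lemma chi_QKchern xi : chi xi = evalat0 (QKchern xi * td).
Proof.
have [n [E [_ ->]]] := QK_frac xi.
rewrite /chi !linearZ /= -qscaleAl Qext_inQ QKchern_inQ Kchern_cls.
rewrite /evalat0 linearZ /= {1}/pval mevalZ; congr (_ * _).
by rewrite QAact_chern -htd.2 /= /chiZ Kact_cls.
Qed.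

(** * Duality, Todd operator and determinant *)

Section Dual.
Variable vee : {rmorphism Kring f -> Kring f}.
Hypothesis veeT : forall u, vee (clsT f u) = clsT f (- u).

Lemma Kchern_vee k : Kchern (vee k) = sgn (Kchern k).
Proof.
have [E ->] : exists E, k = clsSh f E := aclsP k.
elim/gr_ind: E => [|u|E IH|E F IHE IHF].
- by rewrite !raddf0.
- by rewrite veeT !Kchern_cls -ginvU chern_ginv.
- by rewrite !raddfN /= IH.
- by rewrite !raddfD /= IHE IHF.
Qed.

Lemma QKchern_Qdual xi : QKchern (Qdual vee xi) = sgn (QKchern xi).
Proof.
have [n [k [_ ->]]] := Qtensor_frac xi.
rewrite /Qdual !linearZ /=; congr (_ *: _).
by rewrite Qext_inQ /= !QKchern_inQ Kchern_vee.
Qed.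

(** Applying [sgn] absorbs the sign [(-1)^d] and undoes the dual of [xi]. Both sides then pair
    [QKchern xi] with a fixed element, and the pairing is nondegenerate. *)
Lemma dualizing_classP omega :
  is_dualizing_class d vee omega <-> QKchern omega * td = sgn td.
Proof.
have chi_dual xi : (-1) ^+ d * chi (omega * Qdual vee xi) =
    evalat0 (QKchern xi * sgn (QKchern omega * td)).
  rewrite chi_QKchern rmorphM /= QKchern_Qdual -evalat0_sgn.
  by rewrite !rmorphM /= sgnK mulrCA mulrA.
split=> [h|h xi]; last by rewrite chi_dual h sgnK chi_QKchern.
apply: (can_inj sgnK); rewrite sgnK.
apply/esym/eqP; rewrite -subr_eq0; apply/eqP/evalat0_eq0 => E.
rewrite mulrBr /evalat0 raddfB /= {1}/pval mevalB -!/(pval _ 0) -!/(evalat0 _).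
have := h (inQ (clsSh f E)); rewrite chi_dual chi_QKchern QKchern_inQ Kchern_cls.
by move=> ->; rewrite subrr.
Qed.

Lemma Todd_vee Td k : is_todd_operator Td -> Td (vee k) = sgn (Td k).
Proof.
move=> [[TdU TdD] TdT]; move: k.
apply: (@hom_to_units_eq _ _ _ (Td \o vee) (sgn \o Td)).
- by split=> [a|a b]; [exact: TdU|rewrite /= raddfD TdD].
- split=> [a|a b]; last by rewrite /= TdD rmorphM.
  by have [y yT] := TdU a; exists (sgn y); rewrite -rmorphM yT rmorph1.
move=> u; rewrite /= veeT !TdT linear_sum; apply: eq_bigr => i _.
by rewrite linearZ /= rmorphXn /= sgn_clsD clsDN raddfN.
Qed.

(** Both sides turn sums into products of units, and at [T^u] the equation is [qtodd_opp]. *)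
Lemma Todd_det Td det k : is_todd_operator Td -> is_det_operator det ->
  Td k = Kchern (det k) * Td (vee k).
Proof.
move=> [[TdU TdD] TdT] [[detU detD] detT]; move: k.
apply: (@hom_to_units_eq _ _ _ Td (fun k => Kchern (det k) * Td (vee k))) => //.
  split=> [a|a b]; last by rewrite raddfD detD TdD rmorphM mulrACA.
  have [y yT] := TdU (vee a); have [z zD] := detU a.
  by exists (Kchern z * y); rewrite mulrACA yT -rmorphM zD rmorph1 mulr1.
move=> u; rewrite detT veeT Kchern_cls chernU !TdT clsDN raddfN.
exact/qtodd_opp/inQ_clsD_nilpotent.
Qed.

End Dual.
End ToddClass.
End SignInvolution.

(** * The dualizing class and its formula in terms of a cotangent class *)

Unset Implicit Arguments.

Theorem theorem1p3 (L : lattice) (f g : polyfun L) (d : nat)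
    (hRR : riemann_roch_pair f g) (hd : d = (msize g).-1) :
  exists vee : {rmorphism Kring f -> Kring f},
    is_dualizing_morphism vee /\
    exists omega : Qtensor (Kring f),
      [/\ is_dualizing_class d vee omega,
          forall omega', is_dualizing_class d vee omega' -> omega' = omega &
          forall (td : Qtensor (Aring g)) (Td : Kring f -> Qtensor (Aring g))
                 (det : Kring f -> Kring f),
            is_todd_class f td -> is_todd_operator Td -> is_det_operator det ->
            forall Omega : Kring f, td = Td (vee Omega) ->
              omega = inQ (det Omega)].
Proof.
have [hg [td htd]] := hRR; subst d.
have [vee [veeK veeT]] := dualizing_morphism_exists hg htd.
exists vee; split=> //.
have [t tK] := htd.1.
(* With [t] the inverse of [td], this solves [QKchern omega * td = sgn td]. *)
have [omega omegaE] := QKchern_surj htd (sgn hg td * t).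
have omegaP : is_dualizing_class (msize g).-1 vee omega.
  by apply/(dualizing_classP hg htd veeT); rewrite omegaE -mulrA tK mulr1.
have uniq omega' : is_dualizing_class (msize g).-1 vee omega' -> omega' = omega.
  move=> /(dualizing_classP hg htd veeT) e; apply: (QKchern_inj (htd := htd)).
  by rewrite omegaE -e -mulrA [_ * t]mulrC tK mulr1.
exists omega; split=> // td' Td det htd' hTd hdet Omega td'E.
(* By uniqueness, it suffices that [det Omega] satisfies the criterion for the given Todd class
   [td']. *)
apply/esym/uniq/(dualizing_classP hg htd' veeT).
(* Dualizing [Omega] twice gives it back. *)
have -> : sgn hg td' = Td Omega.
  by rewrite td'E -(Todd_vee hg veeT _ hTd) veeK.
by rewrite QKchern_inQ (Todd_det htd' veeT Omega hTd hdet) -td'E.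
Qed.
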